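(* Let $r\ge 2$ be an integer and let $\mathcal{H}_k$ be a truncated space of order $r$ corresponding to the orthonormal basis $\{f_n\}_{n\ge 0}$, $f_n(z)=(a_n+b_nz)z^n$. For $1\le m\le n\le r+1$ let $c_{mn}=\langle|M_z|^{-1}f_n,f_m\rangle_{\mathcal{H}_k}$ be the $(m,n)$ entry of the matrix of $|M_z|^{-1}$ with respect to $\{f_n\}_{n\ge 0}$. Then the Shimorin-Aluthge kernel of $M_z$ is tridiagonal if and only if $$c_{mn}=(-1)^{n-m-1}\,\frac{\bar b_{m+1}\cdots\bar b_{n-1}}{\bar a_{m+2}\cdots\bar a_n}\,c_{m,m+1}$$ for all $1\le m\le n-2$ and $3\le n\le r+1$.
   Context: $\mathbb{D}$ is the open unit disc, $\mathcal{O}(\mathbb{D})$ the space of analytic functions on $\mathbb{D}$. For a positive definite scalar kernel $k$ on $\mathbb{D}$, analytic in the first variable, $\mathcal{H}_k$ is its reproducing kernel Hilbert space, and the shift is $(M_zf)(w)=wf(w)$. An analytic tridiagonal space is such an $\mathcal{H}_k$ with $\mathbb{C}[z]\subseteq\mathcal{H}_k\subseteq\mathcal{O}(\mathbb{D})$ for which there are complex scalars $\{a_n\}_{n\ge 0}$, $\{b_n\}_{n\ge 0}$, $a_n\ne 0$ for all $n$, with $\sup_n|a_n/a_{n+1}|<\infty$, $\limsup_n|b_n/a_{n+1}|<1$, $\{|a_n/a_{n+1}|\}_{n\ge0}$ bounded away from zero, and such that $f_n(z)=(a_n+b_nz)z^n$, $n\ge 0$, form an orthonormal basis of $\mathcal{H}_k$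 (so $k(z,w)=\sum_nf_n(z)\overline{f_n(w)}$). Then $M_z$ is bounded and left-invertible. It is a truncated space of order $r\ge 2$ if moreover $b_n=0$ for all $n\notin\{2,3,\dots,r\}$. (The matrix of $|M_z|^{-1}$ is block diagonal with blocks on the indices $\{0\}$, $\{1,\dots,r+1\}$ and diagonal afterwards; the $c_{mn}$ above are the entries of the middle block.) For a bounded operator $T$: $|T|=(T^*T)^{1/2}$; $T=U|T|$ is the polar decomposition with $\ker U=\ker T$; $\tilde T=|T|^{1/2}U|T|^{1/2}$ is the Aluthge transform; if $T$ is left-invertible, $L_T=(T^*T)^{-1}T^*$ is the Shimorin left inverse. The Shimorin-Aluthge kernel of a left-invertible shift $M_z$ is $\tilde k(z,w)=P_{\tilde{\mathcal{W}}}(I-zL)^{-1}(I-\bar wL^* )^{-1}|_{\tilde{\mathcal{W}}}$, where $\tilde{\mathcal{W}}=\ker\tilde M_z^*=|M_z|^{-1/2}\ker M_z^*$, $P_{\tilde{\mathcal{W}}}$ is the orthogonal projection onto $\tilde{\mathcal{W}}$, and $L=|M_z|^{1/2}\big((L_{M_z}|M_z|M_z)^{-1}L_{M_z}\big)|M_z|^{1/2}$ $(=L_{\tilde M_z})$, for $z,w$ in the disc $\{|z|<1/r(L)\}$ ($r(L)$ here denoting the spectral radius of $L$). A kernel with expansion $\sum_{m,n\ge 0}C_{mn}z^m\bar w^n$ about the origin is tridiagonal if $C_{mn}=0$ whenever $|m-n|\ge 2$. *)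

(* Defs.v *)
(* The complex numbers are [R[i]] with [R : realType]; norms of complex numbers
   and of vectors are [R[i]]-valued, [normc z : R] is the real-valued modulus. *)
From HB Require Import structures.
From mathcomp Require Import all_boot all_order all_algebra.
From mathcomp Require Import sesquilinear complex.
From mathcomp Require Import all_classical all_reals all_analysis.

Set Implicit Arguments.
Unset Strict Implicit.
Unset Printing Implicit Defensive.

Import Order.TTheory GRing.Theory Num.Theory.
Import numFieldNormedType.Exports.
Import Normc.

Local Open Scope classical_set_scope.
Local Open Scope ring_scope.

Definition unit_disc (R : realType) : set R[i] := [set z | `|z| < 1].

Definition holomorphic_on_disc (R : realType) (g : R[i] -> R[i]) : Prop :=
  forall z, unit_disc z -> derivable (g : R[i]^o -> R[i]^o) z 1.

Definition positive_definite_kernel (R : realType)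
    (k : R[i] -> R[i] -> R[i]) : Prop :=
  forall (n : nat) (w c : 'I_n -> R[i]), (forall i, unit_disc (w i)) ->
    0 <= \sum_(i < n) \sum_(j < n) Num.conj (c i) * c j * k (w i) (w j).

(* The reproducing kernel Hilbert space of [k], which is determined by [k] up
   to a unitary preserving point evaluations.  Its vectors are functions on the
   disc: [ev h] is the function given by [h].  Only the values of [ev h] and
   [k] on the disc are meaningful. *)
Record rkhs (R : realType) (k : R[i] -> R[i] -> R[i]) := RKHS {
  rkhs_space :> completeNormedModType R[i] ;
  ip : {dot rkhs_space for Num.conj} ;
  ip_norm : forall h, ip h h = `|h| ^+ 2 ;
  ev : rkhs_space -> R[i] -> R[i] ;
  ev_linear : forall (c : R[i]) (g h : rkhs_space) (z : R[i]), unit_disc z ->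
    ev (c *: g + h) z = c * ev g z + ev h z ;
  ev_inj : forall g h, (forall z, unit_disc z -> ev g z = ev h z) -> g = h ;
  ev_reproducing : forall w, unit_disc w -> exists kw : rkhs_space,
    (forall z, unit_disc z -> ev kw z = k z w) /\
    (forall h, ip h kw = ev h w)
}.

Arguments ip {R k r}.
Arguments ev {R k r}.

Section Operators.
Variables (R : realType) (k : R[i] -> R[i] -> R[i]) (H : rkhs k).
Implicit Types (T S U P : H -> H) (W : set H).

(* [adjoint], [op_inv], [op_sqrt], [polar_isometry], [orth_proj] and [mult_z]
   are total: each is the unique map with the stated property when there is
   one, and an arbitrary map otherwise. *)

Definition bounded_op T : Prop := linear T /\ continuous T.

Definition op_ker T : set H := [set h | T h = 0].

Definition adjoint T : H -> H :=
  get [set S : H -> H | forall g h, ip (T g) h = ip g (S h)].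

Definition is_op_inv T S : Prop :=
  [/\ bounded_op S, S \o T = id & T \o S = id].

Definition op_inv T : H -> H := get [set S | is_op_inv T S].

Definition positive_op T : Prop :=
  bounded_op T /\ forall h, 0 <= ip (T h) h.

Definition op_sqrt T : H -> H :=
  get [set S | positive_op S /\ S \o S = T].

Definition op_abs T : H -> H := op_sqrt (adjoint T \o T).

Definition partial_isometry U : Prop :=
  bounded_op U /\
  forall h, (forall g, op_ker U g -> ip h g = 0) -> `|U h| = `|h|.

Definition polar_isometry T : H -> H :=
  get [set U | [/\ partial_isometry U, U \o op_abs T = T
                 & op_ker U = op_ker T]].

Definition aluthge T : H -> H :=
  op_sqrt (op_abs T) \o polar_isometry T \o op_sqrt (op_abs T).

Definition shimorin_inv T : H -> H := op_inv (adjoint T \o T) \o adjoint T.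

Definition orth_proj W : H -> H :=
  get [set P : H -> H | forall h,
         W (P h) /\ forall g, W g -> ip (h - P h) g = 0].

Definition op_spectrum T : set R[i] :=
  [set l | ~ exists S, is_op_inv (fun h => l *: h - T h) S].

Definition spectral_radius T : \bar R :=
  ereal_sup [set (normc l)%:E | l in op_spectrum T].

Definition mult_z : H -> H :=
  get [set T : H -> H | forall h w, unit_disc w -> ev (T h) w = w * ev h w].

Definition sa_wandering T : set H := op_ker (adjoint (aluthge T)).

Definition sa_left_inv T : H -> H :=
  let A := op_abs T in let L := shimorin_inv T in
  op_sqrt A \o (op_inv (L \o A \o T) \o L) \o op_sqrt A.

(* The disc |z| < 1 / r(L). *)
Definition sa_disc T : set R[i] :=
  [set z | ((normc z)%:E * spectral_radius (sa_left_inv T) < 1)%E].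

(* The Shimorin-Aluthge kernel.  It is to be evaluated at [z], [w] in
   [sa_disc T] and on vectors of [sa_wandering T] only. *)
Definition sa_kernel T (z w : R[i]) : H -> H :=
  let L := sa_left_inv T in
  orth_proj (sa_wandering T)
    \o op_inv (fun h => h - z *: L h)
    \o op_inv (fun h => h - Num.conj w *: adjoint L h).

(* An operator-valued kernel [K], with domain [D] and with values acting on the
   subspace [W], is the sum of a power series in [z] and [conj w] with
   coefficients [C m n], absolutely convergent near the origin. *)
Definition kernel_expansion W (D : set R[i]) (K : R[i] -> R[i] -> H -> H)
    (C : nat -> nat -> H -> H) : Prop :=
  (forall m n, bounded_op (C m n) /\ forall h, W h -> W (C m n h)) /\
  exists rho : R[i], [/\ 0 < rho, (forall z : R[i], `|z| < rho -> D z)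
    & forall (z w : R[i]) (h : H), `|z| < rho -> `|w| < rho -> W h ->
      let t m n := (z ^+ m * Num.conj w ^+ n) *: C m n h in
      (exists B : R[i], forall N, \sum_(m < N) \sum_(n < N) `|t m n| <= B) /\
      (fun N : nat => \sum_(m < N) \sum_(n < N) t m n) @ \oo --> K z w h].

Definition tridiagonal_kernel W (D : set R[i])
    (K : R[i] -> R[i] -> H -> H) : Prop :=
  exists C : nat -> nat -> H -> H, kernel_expansion W D K C /\
    forall m n : nat, (m.+2 <= n)%N || (n.+2 <= m)%N ->
      forall h, W h -> C m n h = 0.

Definition orthonormal_basis (f : nat -> H) : Prop :=
  (forall m n, ip (f m) (f n) = (m == n)%:R) /\
  (forall h, series (fun n => ip h (f n) *: f n) @ \oo --> h).

Definition analytic_tridiagonal_space (a b : nat -> R[i])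
    (f : nat -> H) : Prop :=
  [/\ positive_definite_kernel k,
      (forall w, unit_disc w -> holomorphic_on_disc (k ^~ w)),
      (forall p : {poly R[i]}, exists h : H,
          forall z, unit_disc z -> ev h z = p.[z])
    & (forall h : H, holomorphic_on_disc (ev h))] /\
  [/\ (forall n, a n != 0),
      (exists B : R, forall n, normc (a n / a n.+1) <= B),
      (limn_esup (fun n => (normc (b n / a n.+1))%:E) < 1)%E
    & (exists2 e : R, 0 < e & forall n, e <= normc (a n / a n.+1))] /\
  (forall n z, unit_disc z -> ev (f n) z = (a n + b n * z) * z ^+ n) /\
  orthonormal_basis f.

Definition truncated_space (r : nat) (a b : nat -> R[i])
    (f : nat -> H) : Prop :=
  analytic_tridiagonal_space a b f /\
  forall n, ~~ (2 <= n <= r)%N -> b n = 0.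

(* [abs_inv_coef f m n] is the (m, n) matrix entry of |M_z|^-1 in the basis
   [f]; [ip] is linear in its first argument. *)
Definition abs_inv_coef (f : nat -> H) (m n : nat) : R[i] :=
  ip (op_inv (op_abs mult_z) (f n)) (f m).

End Operators.

Arguments mult_z {R k} H.

(* Main.v *)
Require Import Defs.
From HB Require Import structures.
From mathcomp Require Import all_boot all_order all_algebra.
From mathcomp Require Import sesquilinear spectral complex.
From mathcomp Require Import all_classical all_reals all_analysis.
From mathcomp Require Import ring zify.
Set Implicit Arguments.
Unset Strict Implicit.
Unset Printing Implicit Defensive.
Import Order.TTheory GRing.Theory Num.Theory.
Import numFieldNormedType.Exports.
Local Open Scope classical_set_scope.
Local Open Scope ring_scope.

(** Write [M] for the shift, [D = |M|], [Q = D^(1/2)] and [B = (M* M)^-1 M*].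

    The Aluthge transform is [Q M Q^-1], so it is similar to [M], and its
    Shimorin left inverse is [L = Q B Q^-1].  The kernel of [M*] is the line of
    [f 0], the constants; because [b 0 = b 1 = 0] this line is fixed by [Q], so
    it is also the wandering space of the Aluthge transform.  The coefficient
    of [z^m conj(w)^n] in the Shimorin-Aluthge kernel is the compression of
    [L^m L*^n] to that line, which is a positive constant times
    [< D^-1 B*^n (f 0), B*^m (f 0) >].

    The operator [B] removes the constant term of a power series and divides by
    [z], so [B*^n (f 0)] is a fixed multiple of the vector [g n] representing
    the [n]-th Taylor coefficient, and
    [g n = conj (a n) f n + conj (b (n-1)) f (n-1)].  Tridiagonality therefore
    means [< D^-1 (g n), g m > = 0] for [n >= m + 2]
    ([tridiagonal_mult_zP]).  Expanding [g m] and inducting on [m], this amounts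
    to [< D^-1 (g n), f m > = 0], that is, to the two-term recurrence
    [conj (a n) c_(m,n) + conj (b (n-1)) c_(m,n-1) = 0] for [n >= m + 2]
    ([tridiagonal_mult_z_recurrence]).  It is automatic for [m = 0] and for
    [n > r + 1], where the matrix of [D^-1] is diagonal, and the formula of the
    theorem is its solution on the remaining block.

    Three points of analysis support this computation.  The operator [M* M] is
    diagonal in the basis [f] except on a finite block, so the finite spectral
    theorem diagonalizes it in an orthonormal basis ([block_eigenbasis]), and
    [D], [Q] and their inverses are diagonal operators in that basis; their
    uniqueness is a two-line computation on eigenvectors
    ([positive_op_sqr_eigen]).  Near the origin the kernel is a product of two
    Neumann series ([kernel_expansion_resolvents]).  Finally, the coefficients
    of such an expansion are unique ([kernel_expansion_unique]), by looking at
    the terms of least total degree. *)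

(** * Bounded operators on a Hilbert space *)

Section LinearMaps.
Variables (K : numFieldType) (V W : normedModType K).

Lemma linear_bound_continuous (T : V -> W) (c : K) :
  linear T -> (forall h, `|T h| <= c * `|h|) -> continuous T.
Proof.
move=> lT bT.
pose T' : {linear V -> W} := HB.pack T (GRing.isLinear.Build _ _ _ _ T lT).
apply: (@bounded_linear_continuous _ _ _ T').
apply/ex_bound; exists `|c|; apply/nbhs_norm0P; exists 1 => //= x /= x1.
apply: (le_trans (bT x)); rewrite -[leLHS]ger0_norm ?(le_trans _ (bT x)) //.
by rewrite normrM normr_id ler_piMr // ltW.
Qed.

Lemma continuous_linear_bound (T : V -> W) :
  linear T -> continuous T ->
  exists2 c : K, 0 <= c & forall h, `|T h| <= c * `|h|.
Proof.
move=> lT cT.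
pose T' : {linear V -> W} := HB.pack T (GRing.isLinear.Build _ _ _ _ T lT).
have /linear_boundedP : bounded_near T' (nbhs 0).
  by apply: continuous_linear_bounded; exact: cT.
by move=> /pinfty_ex_gt0[c c0 Hc]; exists c => //; exact: ltW.
Qed.

End LinearMaps.

Section HilbertSpace.
Variables (R : realType) (k : R[i] -> R[i] -> R[i]) (H : rkhs k).
Local Notation C := R[i].
Implicit Types (u v w h g : H) (T S : H -> H).

Lemma ip_conj u v : ip u v = (ip v u)^*.
Proof. by rewrite (hermC ip u v) expr0 mul1r. Qed.

Lemma ip_eq0 u : ip u u = 0 -> u = 0.
Proof. by rewrite ip_norm => /eqP; rewrite expf_eq0 /= normr_eq0 => /eqP. Qed.

Lemma ip_ext u v : (forall h, ip h u = ip h v) -> u = v.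
Proof.
move=> uv; apply/eqP; rewrite -subr_eq0; apply/eqP/ip_eq0.
by rewrite linearBr /= uv subrr.
Qed.

Lemma ip_extl u v : (forall h, ip u h = ip v h) -> u = v.
Proof. by move=> uv; apply: ip_ext => h; rewrite ip_conj uv -ip_conj. Qed.

Lemma ipZl (a : C) u w : ip (a *: u) w = a * ip u w.
Proof. exact: linearZl_LR. Qed.

Lemma ipZr (a : C) u w : ip w (a *: u) = a^* * ip w u.
Proof. exact: linearZr_LR. Qed.

Lemma ip_suml I (s : seq I) (P : pred I) (F : I -> H) u :
  ip (\sum_(i <- s | P i) F i) u = \sum_(i <- s | P i) ip (F i) u.
Proof.
by apply: (big_morph (fun v => ip v u)) => [x y|]; [exact: linearDl | exact: linear0l].
Qed.

Lemma ip_sumr I (s : seq I) (P : pred I) (F : I -> H) u :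
  ip u (\sum_(i <- s | P i) F i) = \sum_(i <- s | P i) ip u (F i).
Proof.
by apply: (big_morph (ip u)) => [x y|]; [exact: linearDr | exact: linear0r].
Qed.

Lemma cauchy_schwarz u v : `|ip u v| <= `|u| * `|v|.
Proof.
have [->|v0] := eqVneq v 0; first by rewrite linear0r normr0 mulr_ge0.
rewrite -(@ler_pXn2r _ 2) ?nnegrE ?mulr_ge0 // exprMn -!ip_norm normCK.
have vv : 0 < ip v v by exact: neq0_dnorm_gt0.
rewrite -(ler_pM2r vv) -subr_ge0.
have : 0 <= ip (ip v v *: u - ip u v *: v) (ip v v *: u - ip u v *: v).
  by rewrite ip_norm exprn_ge0.
rewrite linearBl /= !linearBr /= !ipZl !ipZr -(ip_conj v u) -(ip_conj v v) => ge0.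
by congr (0 <= _): ge0; ring.
Qed.

Lemma ip_continuous v : continuous ((fun u => ip u v) : H -> C^o).
Proof.
apply: (@linear_bound_continuous _ _ _ _ `|v|).
  by move=> a x y; rewrite linearDl /= ipZl.
by move=> h; rewrite mulrC; exact: cauchy_schwarz.
Qed.

Lemma cvg_ip (u : nat -> H) (l : H) : u @ \oo --> l ->
  forall v, (fun n => ip (u n) v : C^o) @ \oo --> (ip l v : C^o).
Proof. move=> ul v.
exact: (@cvg_comp _ _ _ u (fun w => ip w v : C^o) _ _ _ ul (@ip_continuous v l)). Qed.

Lemma bounded_op_cvg T (u : nat -> H) (l : H) : bounded_op T ->
  u @ \oo --> l -> (fun n => T (u n)) @ \oo --> T l.
Proof. by move=> [_ cT] ul; apply: cvg_comp ul _; exact: cT. Qed.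

Lemma bounded_op_bound T : bounded_op T ->
  exists2 c : C, 0 <= c & forall h, `|T h| <= c * `|h|.
Proof. by move=> [lT cT]; exact: continuous_linear_bound. Qed.

Lemma bounded_opI T (c : C) :
  linear T -> (forall h, `|T h| <= c * `|h|) -> bounded_op T.
Proof. by move=> lT bT; split => //; apply: linear_bound_continuous bT. Qed.

Lemma bounded_op_comp T S : bounded_op T -> bounded_op S -> bounded_op (T \o S).
Proof.
move=> [lT cT] [lS cS]; split; first by move=> a x y /=; rewrite lS lT.
by move=> x; apply: continuous_comp; [exact: cS | exact: cT].
Qed.

Lemma bounded_op_id : bounded_op (@id H).
Proof. by split=> // x; exact: cvg_id. Qed.

Lemma bounded_op0 T : bounded_op T -> T 0 = 0.
Proof.
by case=> lT _; have := lT (-1) 0 0; rewrite scaler0 addr0 scaleN1r addNr.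
Qed.

Lemma bounded_opD T u v : bounded_op T -> T (u + v) = T u + T v.
Proof. by case=> lT _; have := lT 1 u v; rewrite !scale1r. Qed.

Lemma bounded_opZ T (a : C) u : bounded_op T -> T (a *: u) = a *: T u.
Proof.
by move=> bT; have := bT.1 a u 0; rewrite addr0 (bounded_op0 bT) addr0.
Qed.

Lemma bounded_op_sum T I (s : seq I) (P : pred I) (F : I -> H) : bounded_op T ->
  T (\sum_(i <- s | P i) F i) = \sum_(i <- s | P i) T (F i).
Proof.
by move=> bT; apply: big_morph => [x y|]; [exact: bounded_opD | exact: bounded_op0].
Qed.

Lemma bounded_op_add T S : bounded_op T -> bounded_op S ->
  bounded_op (fun h => T h + S h).
Proof.
move=> bT bS; have [c c0 Tc] := bounded_op_bound bT.
have [d d0 Sd] := bounded_op_bound bS.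
apply: (bounded_opI (c := c + d)) => [a u v|h].
  by rewrite bT.1 bS.1 scalerDr addrACA.
by apply: (le_trans (ler_normD _ _)); rewrite mulrDl lerD.
Qed.

Lemma bounded_op_sub Z : bounded_op Z -> bounded_op (fun h => h - Z h).
Proof.
move=> bZ; have [c c0 Zc] := bounded_op_bound bZ.
apply: (bounded_opI (c := 1 + c)) => [a u v|h].
  by rewrite bZ.1 scalerBr opprD addrACA.
by apply: (le_trans (ler_normB _ _)); rewrite mulrDl mul1r lerD2l.
Qed.

Lemma bounded_op_scale (T : H -> H) (z : C) : bounded_op T ->
  bounded_op (fun h => z *: T h).
Proof.
move=> bT; have [c c0 Tc] := bounded_op_bound bT.
apply: (bounded_opI (c := `|z| * c)) => [a u v|h].
  by rewrite bT.1 scalerDr !scalerA mulrC.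
by rewrite normrZ -mulrA ler_wpM2l.
Qed.

Lemma bounded_op_iter T n : bounded_op T -> bounded_op (iter n T).
Proof.
by move=> bT; elim: n => [|n IH]; [exact: bounded_op_id | exact: (bounded_op_comp bT IH)].
Qed.

Lemma bounded_finite_rank (N : nat) (x y : nat -> H) :
  bounded_op (fun h => \sum_(i < N) ip h (x i) *: y i).
Proof.
apply: (bounded_opI (c := \sum_(i < N) `|x i| * `|y i|)) => [a u v|h].
  rewrite scaler_sumr -big_split /=; apply: eq_bigr => i _.
  by rewrite linearDl /= ipZl scalerDl scalerA.
apply: (le_trans (ler_norm_sum _ _ _)); rewrite mulr_suml.
apply: ler_sum => i _; rewrite normrZ mulrAC ler_wpM2r // mulrC.
exact: cauchy_schwarz.
Qed.

Lemma iter_scale (T : H -> H) (z : C) n h : bounded_op T ->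
  iter n (fun h => z *: T h) h = z ^+ n *: iter n T h.
Proof.
move=> bT; elim: n => [|n IH]; first by rewrite expr0 scale1r.
by rewrite /= IH bounded_opZ // scalerA exprS.
Qed.

(** Norms are valued in [R[i]], whose order is partial, so a Cauchy estimate is
    imported from a bounded monotone sequence [s] of reals.  The square suits
    orthogonal series, where Pythagoras gives the increments of [s]. *)
Lemma cvg_of_real_gauge (u : nat -> H) (s : nat -> R) (b : R) :
  (forall m n, (m <= n)%N -> `|u n - u m| ^+ 2 <= (s n - s m)%:C%C) ->
  (forall n, s n <= b) -> cvgn u.
Proof.
move=> us sb.
have ndm m n : (m <= n)%N -> s m <= s n.
  move=> mn; rewrite -subr_ge0 -lecR; apply: le_trans (us _ _ mn).
  by rewrite exprn_ge0.
have cs : cvgn s.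
  by apply: nondecreasing_is_cvgn => //; exists b => _ [n _ <-].
have sl n : s n <= limn s by exact: nondecreasing_cvgn_le.
apply/cauchy_cvgP/cauchy_exP => e e0.
have er : e \is Num.real by exact: gtr0_real.
have eE : e = (complex.Re e)%:C%C by rewrite RRe_real.
have e'0 : 0 < complex.Re e by rewrite -ltcR -eE.
have [N _ HN] : \forall n \near \oo, `|limn s - s n| < complex.Re e ^+ 2.
  by move: cs => /cvgrPdist_lt; apply; rewrite exprn_gt0.
exists (u N); exists N => // n /= Nn.
rewrite -ball_normE /= distrC -(@ltr_pXn2r _ 2) ?nnegrE ?(ltW e0) //.
apply: (le_lt_trans (us _ _ Nn)); rewrite eE -rmorphXn ltcR.
apply: le_lt_trans (HN _ (leqnn _)); rewrite ger0_norm ?subr_ge0 //.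
by rewrite lerB.
Qed.

End HilbertSpace.

(** * Orthonormal systems *)

Section OrthonormalSystems.
Variables (R : realType) (k : R[i] -> R[i] -> R[i]) (H : rkhs k).
Local Notation C := R[i].
Implicit Types (u v w h : H) (T S : H -> H) (f : nat -> H).

Definition orthonormal_seq f := forall m n, ip (f m) (f n) = (m == n)%:R.

(** The order of [R[i]] is partial, but the two sides compared are real. *)
Lemma norm_cvg_le (u : nat -> H) (l : H) (c : C) :
  u @ \oo --> l -> (forall n, `|u n| <= c) -> `|l| <= c.
Proof.
move=> ul uc; have c0 : 0 <= c by apply: le_trans (uc 0%N).
have [//|cl] := real_leP (normr_real l) (ger0_real c0).
have e0 : 0 < `|l| - c by rewrite subr_gt0.
move/cvgrPdist_lt: ul => /(_ _ e0)[N _ /(_ _ (leqnn N))] lN.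
have : `|l| <= `|l - u N| + `|u N|.
  by rewrite -{1}(subrK (u N) l) ler_normD.
move=> /le_lt_trans /(_ (ltr_leD lN (uc N))).
by rewrite subrK ltxx.
Qed.

Lemma norm_sum_orthonormal (g : nat -> H) (x : nat -> C) m n : orthonormal_seq g ->
  `|\sum_(m <= i < n) x i *: g i| ^+ 2 = \sum_(m <= i < n) `|x i| ^+ 2.
Proof.
move=> og; rewrite -ip_norm ip_suml /=.
apply: eq_big_nat => i /andP[mi ni].
rewrite ipZl ip_sumr /= (bigD1_seq i) ?mem_index_iota ?mi ?iota_uniq //=.
rewrite big1 ?addr0 => [|j ij]; rewrite ipZr og ?eqxx ?mulr1 ?normCK //.
by rewrite eq_sym (negPf ij) mulr0.
Qed.

Lemma cvg_ip_eventually (u : nat -> H) (l v : H) (c : C) (N : nat) :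
  u @ \oo --> l -> (forall n, (N <= n)%N -> ip (u n) v = c) -> ip l v = c.
Proof.
move=> ul uc.
have cc : (fun n => ip (u n) v : C^o) @ \oo --> (c : C^o).
  apply: cvg_near_cst; exists N => // n /= Nn; exact: uc.
have cl := @cvg_ip _ _ _ _ _ ul v.
have H0 := (@cvg_unique _ (@norm_hausdorff _ C^o)).
apply: (H0 _ _ _ _ cl cc).
Qed.

(** Riesz-Fischer: the partial sums are Cauchy because their increments have
    squared norm equal to those of the bounded series of the [`|x i| ^+ 2]. *)
Lemma orthonormal_series_cvg (g : nat -> H) (x : nat -> C) (c : C) : orthonormal_seq g ->
  0 <= c -> (forall N, \sum_(0 <= i < N) `|x i| ^+ 2 <= c ^+ 2) ->
  exists v, [/\ series (fun n => x n *: g n) @ \oo --> v, `|v| <= c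
              & forall n, ip v (g n) = x n].
Proof.
move=> og c0 xc.
pose s N := complex.Re (\sum_(0 <= i < N) `|x i| ^+ 2).
have sE N : (s N)%:C%C = \sum_(0 <= i < N) `|x i| ^+ 2.
  by rewrite RRe_real // ger0_real // sumr_ge0 // => i _; rewrite exprn_ge0.
have cv : cvgn (series (fun n => x n *: g n)).
  apply: (@cvg_of_real_gauge _ _ _ _ s (complex.Re (c ^+ 2))) => [m n mn|n].
    rewrite sub_series mn norm_sum_orthonormal // rmorphB /= !sE.
    by rewrite [X in _ <= X - _](@big_cat_nat _ _ _ m) //= addrAC subrr add0r.
  by rewrite -lecR sE RRe_real // ger0_real // exprn_ge0.
exists (limn (series (fun n => x n *: g n))); split => //.
  apply: norm_cvg_le cv _ => n.
  by rewrite -(@ler_pXn2r _ 2) ?nnegrE // norm_sum_orthonormal.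
move=> n; apply: (cvg_ip_eventually (N := n.+1) cv) => N nN.
rewrite /series /= ip_suml /=.
rewrite (bigD1_seq n) ?mem_index_iota ?iota_uniq //=.
rewrite ipZl og eqxx mulr1 big1 ?addr0 // => j jn.
by rewrite ipZl og (negPf jn) mulr0.
Qed.

(** Bessel's inequality for the coefficients that the adjoint of [T], whose
    existence is not yet known, should give to [h].  The partial sum [s]
    satisfies [`|s| ^+ 2 = ip h (T s)], which is at most [c * `|h| * `|s|]. *)
Lemma bessel_adjoint f T (c : C) h N : orthonormal_seq f -> bounded_op T ->
  0 <= c -> (forall u, `|T u| <= c * `|u|) ->
  \sum_(0 <= i < N) `|ip h (T (f i))| ^+ 2 <= (c * `|h|) ^+ 2.
Proof.
move=> of_ bT c0 Tc.
pose s := \sum_(0 <= i < N) ip h (T (f i)) *: f i.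
have sE : `|s| ^+ 2 = \sum_(0 <= i < N) `|ip h (T (f i))| ^+ 2.
  exact: norm_sum_orthonormal.
have sT : `|s| ^+ 2 = ip h (T s).
  rewrite sE bounded_op_sum // ip_sumr /=; apply: eq_bigr => i _.
  by rewrite bounded_opZ // ipZr normCK mulrC.
rewrite -sE ler_pXn2r ?nnegrE ?mulr_ge0 //.
have [->|s0] := eqVneq s 0; first by rewrite normr0 mulr_ge0.
have sp : 0 < `|s| by rewrite normr_gt0.
rewrite -(ler_pM2r sp) -expr2 -[leLHS]ger0_norm ?exprn_ge0 // sT.
apply: (le_trans (cauchy_schwarz _ _)).
by rewrite mulrAC [c * _ * _]mulrC ler_wpM2l.
Qed.

Lemma bessel f h N : orthonormal_seq f ->
  \sum_(0 <= i < N) `|ip h (f i)| ^+ 2 <= `|h| ^+ 2.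
Proof.
move=> of_; rewrite -[`|h|]mul1r.
apply: (@bessel_adjoint f id 1) => //; first exact: bounded_op_id.
by move=> u; rewrite mul1r.
Qed.

Section Basis.
Variable f : nat -> H.
Hypothesis fB : orthonormal_basis f.

Lemma onb_ext u v : (forall n, ip u (f n) = ip v (f n)) -> u = v.
Proof.
move=> uv; have := fB.2 u; under eq_fun do rewrite uv.
by move=> /(cvg_unique (@norm_hausdorff _ H)); apply; exact: fB.2.
Qed.

Lemma onb_extr u v : (forall n, ip (f n) u = ip (f n) v) -> u = v.
Proof. by move=> uv; apply: onb_ext => n; rewrite ip_conj uv -ip_conj. Qed.

Lemma bounded_op_ext T S : bounded_op T -> bounded_op S ->
  (forall n, T (f n) = S (f n)) -> T = S.
Proof.
move=> bT bS TS; apply/funext => h.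
have Th := bounded_op_cvg bT (fB.2 h); have Sh := bounded_op_cvg bS (fB.2 h).
apply: (cvg_unique (@norm_hausdorff _ H) Th).
suff -> : (fun n => T (series (fun n => ip h (f n) *: f n) n)) =
          (fun n => S (series (fun n => ip h (f n) *: f n) n)) by [].
apply/funext => n; rewrite /series /= !bounded_op_sum //.
by apply: eq_bigr => i _; rewrite !bounded_opZ // TS.
Qed.

(** The vector [S h] is prescribed by its coordinates [ip h (T (f n))], which are
    square summable by [bessel_adjoint]; the identity then passes from partial
    sums to the limit. *)
Lemma adjoint_exists T : bounded_op T ->
  exists2 S, bounded_op S & forall g h, ip (T g) h = ip g (S h).
Proof.
move=> bT; have [c c0 Tc] := bounded_op_bound bT.
have /choice[S HS] : forall h, exists v,
    `|v| <= c * `|h| /\ forall n, ip v (f n) = ip h (T (f n)).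
  move=> h.
  have [v [_ v1 v2]] := orthonormal_series_cvg fB.1 (mulr_ge0 c0 (normr_ge0 h))
    (fun N => bessel_adjoint h N fB.1 bT c0 Tc).
  by exists v.
have ST g h : ip (T g) h = ip g (S h).
  have lim1 := @cvg_ip _ _ _ _ _ (bounded_op_cvg bT (fB.2 g)) h.
  have lim2 := @cvg_ip _ _ _ _ _ (fB.2 g) (S h).
  apply: (cvg_unique (@norm_hausdorff _ C^o) lim1).
  apply: cvg_trans lim2; apply: near_eq_cvg; near=> n.
  rewrite /series /= bounded_op_sum // !ip_suml /=.
  apply: eq_bigr => i _; rewrite bounded_opZ // !ipZl; congr (_ * _).
  by rewrite ip_conj (HS h).2 -ip_conj.
exists S => //; apply: (bounded_opI (c := c)) => [a u v|h]; last exact: (HS h).1.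
by apply: ip_ext => g; rewrite -ST linearDr /= !ipZr linearDr /= !ipZr !ST.
Unshelve. all: by end_near. Qed.

End Basis.
End OrthonormalSystems.

(** * Adjoints, diagonal operators and positive square roots *)

Section AdjointInverse.
Variables (R : realType) (k : R[i] -> R[i] -> R[i]) (H : rkhs k).
Local Notation C := R[i].
Implicit Types (u v w h : H) (T S : H -> H).

(** The operators [op_inv T], [adjoint T], [op_sqrt T] are picked by choice among
    the maps with the defining property; uniqueness of that map is what allows
    them to be computed by exhibiting a candidate. *)
Lemma op_inv_eq T S : is_op_inv T S -> op_inv T = S.
Proof.
move=> TS; have [_ ST' TS'] := TS.
have [_ ST _] : is_op_inv T (op_inv T) by apply: (getPex (P := is_op_inv T)); exists S.
apply/funext => h; have /= TSh := congr1 (@^~ h) TS'.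
by have /= := congr1 (@^~ (S h)) ST; rewrite TSh.
Qed.

Lemma adjoint_eq T S : (forall g h, ip (T g) h = ip g (S h)) -> adjoint T = S.
Proof.
move=> TS; apply/funext => h; apply: ip_ext => g; rewrite -TS.
have := getPex (P := [set S : H -> H | forall g h, ip (T g) h = ip g (S h)]).
by move=> /(_ (ex_intro _ S TS) g h) ->.
Qed.

Variable f : nat -> H.
Hypothesis fB : orthonormal_basis f.

Lemma adjointP T : bounded_op T -> forall g h, ip (T g) h = ip g (adjoint T h).
Proof. by move=> /(adjoint_exists fB)[S _ TS] g h; rewrite (adjoint_eq TS). Qed.

Lemma adjointPr T : bounded_op T -> forall g h, ip (adjoint T g) h = ip g (T h).
Proof. by move=> bT g h; rewrite ip_conj -adjointP // -ip_conj. Qed.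

Lemma bounded_op_adjoint T : bounded_op T -> bounded_op (adjoint T).
Proof. by move=> /(adjoint_exists fB)[S bS TS]; rewrite (adjoint_eq TS). Qed.

(** Taking [g := f] gives the diagonal operators, and [g n := f n.+1] the weighted
    shifts. *)
Lemma weighted_op_exists (g : nat -> H) (c : nat -> C) (b : C) :
  orthonormal_seq g -> (forall n, `|c n| <= b) ->
  exists2 T, bounded_op T & forall n, T (f n) = c n *: g n.
Proof.
move=> og cb.
have b0 : 0 <= b by apply: le_trans (cb 0%N).
have /choice[T HT] : forall h, exists v,
    series (fun n => (c n * ip h (f n)) *: g n) @ \oo --> v /\ `|v| <= b * `|h|.
  move=> h.
  have [N|v [vs vb _]] := @orthonormal_series_cvg _ _ _ g
      (fun n => c n * ip h (f n)) (b * `|h|) og (mulr_ge0 b0 (normr_ge0 h)).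
    apply: (@le_trans _ _ (\sum_(0 <= i < N) b ^+ 2 * `|ip h (f i)| ^+ 2)).
      apply: ler_sum => i _; rewrite normrM exprMn ler_wpM2r ?exprn_ge0 //.
      by rewrite lerXn2r ?nnegrE.
    rewrite -mulr_sumr exprMn ler_wpM2l ?exprn_ge0 //.
    exact: bessel fB.1.
  by exists v.
exists T => [|n].
  apply: (bounded_opI (c := b)) => [a u v|h]; last exact: (HT h).2.
  pose s w := series (fun n => (c n * ip w (f n)) *: g n).
  have lim : (fun n => a *: s u n + s v n) @ \oo --> a *: T u + T v.
    by apply: cvgD; [apply: cvgZl_tmp; exact: (HT u).1 | exact: (HT v).1].
  have sD : (fun n => a *: s u n + s v n) = s (a *: u + v).
    apply/funext => n; rewrite /s /series /= scaler_sumr -big_split /=.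
    apply: eq_bigr => i _; rewrite linearDl /= ipZl scalerA -scalerDl.
    by congr (_ *: _); rewrite mulrDr; congr (_ + _); rewrite mulrCA.
  rewrite sD in lim.
  exact: (cvg_unique (@norm_hausdorff _ H) (HT (a *: u + v)).1 lim).
apply: (cvg_unique (@norm_hausdorff _ H) (HT (f n)).1).
apply: cvg_near_cst; exists n.+1 => // N /= nN.
rewrite /series /= (bigD1_seq n) ?mem_index_iota ?iota_uniq //=.
rewrite fB.1 eqxx mulr1 big1 ?addr0 // => j jn.
by rewrite fB.1 eq_sym (negPf jn) mulr0 scale0r.
Qed.

Definition diagonal_op (c : nat -> C) T :=
  bounded_op T /\ forall n, T (f n) = c n *: f n.

Lemma diagonal_op_exists (c : nat -> C) (b : C) :
  (forall n, `|c n| <= b) -> exists T, diagonal_op c T.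
Proof.
by move=> cb; have [T bT Tf] := weighted_op_exists fB.1 cb; exists T.
Qed.

Lemma norm_onb n : `|f n| = 1.
Proof.
apply/eqP; rewrite -(@eqrXn2 _ 2) ?ler01 // -ip_norm fB.1 eqxx expr1n //.
Qed.

Lemma diagonal_op_bound c T : diagonal_op c T ->
  exists2 b : C, 0 <= b & forall n, `|c n| <= b.
Proof.
move=> [bT Tf]; have [b b0 Tb] := bounded_op_bound bT; exists b => // n.
by have := Tb (f n); rewrite Tf normrZ norm_onb !mulr1.
Qed.

Lemma diagonal_op_comp c d T S : diagonal_op c T -> diagonal_op d S ->
  diagonal_op (fun n => c n * d n) (T \o S).
Proof.
move=> [bT Tf] [bS Sf]; split; first exact: bounded_op_comp.
by move=> n /=; rewrite Sf bounded_opZ // Tf scalerA mulrC.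
Qed.

Lemma diagonal_op_uniq c d T S : diagonal_op c T -> diagonal_op d S ->
  (forall n, c n = d n) -> T = S.
Proof.
move=> [bT Tf] [bS Sf] cd; apply: (bounded_op_ext fB) => // n.
by rewrite Tf Sf cd.
Qed.

Lemma diagonal_op_id : diagonal_op (fun=> 1) id.
Proof. by split; [exact: bounded_op_id|move=> n; rewrite scale1r]. Qed.

Lemma diagonal_op_inv c d T S : diagonal_op c T -> diagonal_op d S ->
  (forall n, c n * d n = 1) -> is_op_inv T S.
Proof.
move=> Tc Sd cd; split; first exact: Sd.1.
  apply: (diagonal_op_uniq (diagonal_op_comp Sd Tc) diagonal_op_id) => n.
  by rewrite mulrC.
exact: (diagonal_op_uniq (diagonal_op_comp Tc Sd) diagonal_op_id).
Qed.

Lemma diagonal_op_sym c T : diagonal_op c T -> (forall n, c n \is Num.real) ->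
  forall g h, ip (T g) h = ip g (T h).
Proof.
move=> [bT Tf] cr g h; rewrite adjointP //; congr (ip g (_ h)).
apply: (bounded_op_ext fB) => //; first exact: bounded_op_adjoint.
move=> n; apply: (onb_extr fB) => m; rewrite -adjointP // !Tf ipZl ipZr fB.1.
by have [->|] := eqVneq m n; rewrite ?mulr0 // conj_Creal.
Qed.

(** With [S] the diagonal square root of [T], which is symmetric, the form
    [ip (T h) h] is [`|S h| ^+ 2]. *)
Lemma diagonal_op_positive c T : diagonal_op c T -> (forall n, 0 <= c n) ->
  positive_op T.
Proof.
move=> Tc c0; split=> [|h]; first exact: Tc.1.
have [b b0 cb] := diagonal_op_bound Tc.
have [n|S Sc] := @diagonal_op_exists (fun n => sqrtC (c n)) (sqrtC b).
  by rewrite ger0_norm ?sqrtC_ge0 // ler_sqrtC ?nnegrE // -[c n]ger0_norm.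
have -> : T = S \o S.
  apply: (diagonal_op_uniq Tc (diagonal_op_comp Sc Sc)) => n.
  by rewrite -expr2 sqrtCK.
rewrite /= (diagonal_op_sym Sc) => [|n]; last by rewrite ger0_real ?sqrtC_ge0.
by rewrite ip_norm exprn_ge0.
Qed.

(** A positive square root has no freedom on an eigenvector of its square: with
    [s := sqrtC c], the vector [v := S h - s *: h] satisfies [S v = - s *: v],
    which positivity of [S] allows only for [v = 0].  This replaces the
    functional calculus in all that follows. *)
Lemma positive_op_sqr_eigen S h (c : C) : positive_op S -> 0 < c ->
  S (S h) = c *: h -> S h = sqrtC c *: h.
Proof.
move=> [bS S0] c0 SSh; pose s := sqrtC c.
have s0 : 0 < s by rewrite sqrtC_gt0.
pose v := S h - s *: h.
have Sv : S v = - s *: v.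
  rewrite /v bounded_opD // SSh -scaleNr bounded_opZ // scalerDr scalerA mulrNN.
  by rewrite -expr2 sqrtCK addrC.
have := S0 v; rewrite Sv ipZl ip_norm mulNr oppr_ge0 pmulr_rle0 // => v0.
have /eqP : `|v| ^+ 2 = 0 by apply/eqP; rewrite eq_le v0 exprn_ge0.
by rewrite expf_eq0 /= normr_eq0 subr_eq0 => /eqP.
Qed.

(** Diagonalizability makes the square root exist, and
    [positive_op_sqr_eigen] makes it unique. *)
Lemma op_sqrt_diagonal c A : diagonal_op c A -> (forall n, 0 < c n) ->
  [/\ diagonal_op (fun n => sqrtC (c n)) (op_sqrt A), positive_op (op_sqrt A)
    & op_sqrt A \o op_sqrt A = A].
Proof.
move=> Ac c0.
have [b b0 cb] := diagonal_op_bound Ac.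
have [n|S Sc] := @diagonal_op_exists (fun n => sqrtC (c n)) (sqrtC b).
  by rewrite ger0_norm ?sqrtC_ge0 ?ler_sqrtC ?nnegrE ?(ltW (c0 _)) //
             -[c n]gtr0_norm.
have [pos sq] : [set S | positive_op S /\ S \o S = A] (op_sqrt A).
  apply: getPex; exists S; split.
    by apply: (diagonal_op_positive Sc) => n; rewrite sqrtC_ge0 ltW.
  apply: (diagonal_op_uniq (diagonal_op_comp Sc Sc) Ac) => n.
  by rewrite -expr2 sqrtCK.
split=> //; split=> [|n]; first exact: pos.1.
apply: positive_op_sqr_eigen => //.
by rewrite -[op_sqrt A _]/((op_sqrt A \o op_sqrt A) _) sq Ac.2.
Qed.

End AdjointInverse.

(** * Diagonalization of an operator with one finite block *)

Section BlockSpectral.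
Variables (R : realType) (k : R[i] -> R[i] -> R[i]) (H : rkhs k).
Local Notation C := R[i].
Implicit Types (u v w h : H) (T S : H -> H).

(** By Bessel the Fourier series of [h] converges; its limit and [h] have the
    same coefficients, so totality identifies them. *)
Lemma onb_of_total (e : nat -> H) : orthonormal_seq e ->
  (forall h, (forall n, ip h (e n) = 0) -> h = 0) -> orthonormal_basis e.
Proof.
move=> oe tot; split=> // h.
have [v [vs _ ve]] := orthonormal_series_cvg oe (normr_ge0 h) (fun N => bessel h N oe).
suff -> : h = v by move: vs; under eq_fun do rewrite -ve.
apply/eqP; rewrite -subr_eq0; apply/eqP/tot => n.
by rewrite linearBl /= ve subrr.
Qed.

Variable f : nat -> H.
Hypothesis fB : orthonormal_basis f.

(** Outside the first [N] basis vectors [A] is already diagonal; by symmetry it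
    then preserves the span of these [N] vectors, where the spectral theorem for
    the Hermitian matrix [G] applies.  The new basis is the unitary image of the
    old one on this block and agrees with it elsewhere. *)
Lemma block_eigenbasis (A : H -> H) (N : nat) (mu : nat -> C) :
  bounded_op A -> (forall g h, ip (A g) h = ip g (A h)) ->
  (forall n, (N <= n)%N -> A (f n) = mu n *: f n) ->
  exists e lam, [/\ orthonormal_basis e, diagonal_op e lam A
    & forall n, (N <= n)%N -> lam n = mu n].
Proof.
move=> bA Asym Af.
pose G : 'M[C]_N := \matrix_(i, j) ip (A (f i)) (f j).
have Gn : G \is normalmx.
  apply: hermitian_normalmx; apply/is_hermitianmxP; rewrite expr0 scale1r.
  by apply/matrixP => i j; rewrite !mxE Asym ip_conj.
pose P := spectralmx G; pose d := spectral_diag G.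
have PG : P *m G = diag_mx d *m P.
  have /orthomx_spectralP -> := Gn.
  by rewrite -/P -/d !mulmxA mulmxV ?mul1mx // spectral_unit.
have /unitarymxP PP : P \is unitarymx by exact: spectral_unitarymx.
(* [insub] decides whether [n] indexes a row of the block. *)
pose e n := if insub n is Some i then \sum_j P i j *: f j else f n.
pose lam n := if insub n is Some i then d 0 i else mu n.
have eI (i : 'I_N) : e i = \sum_j P i j *: f j by rewrite /e valK.
have eN n : (N <= n)%N -> e n = f n by move=> nN; rewrite /e insubN // -leqNgt.
have lamI (i : 'I_N) : lam i = d 0 i by rewrite /lam valK.
have lamN n : (N <= n)%N -> lam n = mu n.
  by move=> nN; rewrite /lam insubN // -leqNgt.
have nP (n : nat) : (exists i : 'I_N, n = i) \/ (N <= n)%N.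
  by case: (ltnP n N) => [nN|]; [left; exists (Ordinal nN)|right].
have ipIf (i j : 'I_N) : ip (e i) (f j) = P i j.
  rewrite eI ip_suml (bigD1 j) //= ipZl fB.1 eqxx mulr1 big1 ?addr0 // => l lj.
  by rewrite ipZl fB.1 (negPf (lj : (l : nat) != j)) mulr0.
have ipIN (i : 'I_N) n : (N <= n)%N -> ip (e i) (f n) = 0.
  move=> nN; rewrite eI ip_suml big1 // => l _.
  by rewrite ipZl fB.1 ltn_eqF ?mulr0 // (leq_trans (ltn_ord l)).
have oe : orthonormal_seq e.
  move=> m n; have [[i ->]|mN] := nP m; have [[j ->]|nN] := nP n.
  - have /matrixP/(_ i j) := PP; rewrite !mxE => <-.
    rewrite [e j]eI ip_sumr; apply: eq_bigr => l _.
    by rewrite ipZr ipIf !mxE mulrC.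
  - by rewrite (eN _ nN) ipIN // ltn_eqF // (leq_trans (ltn_ord i)).
  - by rewrite (eN _ mN) ip_conj ipIN // rmorph0 gtn_eqF // (leq_trans (ltn_ord j)).
  - by rewrite !eN // fB.1.
exists e, lam; split => //.
  apply: onb_of_total => // h he.
  apply: (onb_extr fB) => n; rewrite linear0r /=.
  have [[i ->]|nN] := nP n; last by rewrite -(eN _ nN) ip_conj he rmorph0.
  pose x : 'cV[C]_N := \col_j ip (f j) h.
  have : P *m x = 0.
    apply/matrixP => l j; rewrite !mxE; transitivity (ip (e l) h).
      by rewrite eI ip_suml; apply: eq_bigr => m _; rewrite !mxE ipZl.
    by rewrite ip_conj he rmorph0.
  move=> /(congr1 (mulmx (invmx P))); rewrite mulKmx ?spectral_unit // mulmx0.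
  by move=> /matrixP/(_ i 0); rewrite !mxE.
split=> // n; have [[i ->]|nN] := nP n; last by rewrite eN // Af // lamN.
apply: (onb_ext fB) => m; rewrite ipZl Asym.
have [[j ->]|mN] := nP m; last by rewrite Af // ipZr ipIN // !mulr0.
have /matrixP/(_ i j) := PG; rewrite ipIf lamI mul_diag_mx mxE [RHS]mxE => <-.
rewrite -Asym eI bounded_op_sum // ip_suml; apply: eq_bigr => l _.
by rewrite bounded_opZ // ipZl mxE.
Qed.

End BlockSpectral.

(** * Uniqueness of the coefficients of a double power series *)

Section DoubleSeries.
Variable R : realType.
Local Notation C := R[i].

Lemma poly_zero_of_values (d : nat) (p : {poly C}) : (size p <= d)%N ->
  (forall j : nat, p.[j.+1%:R^-1] = 0) -> p = 0.
Proof.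
move=> sp p0; apply/eqP/negP => /negP pn0.
pose s : seq C := [seq j.+1%:R^-1 | j <- iota 0 d].
have us : uniq s.
  rewrite map_inj_uniq ?iota_uniq // => i j /invr_inj /eqP.
  by rewrite eqr_nat eqSS => /eqP.
have rs : all (root p) s by apply/allP => _ /mapP[j _ ->]; apply/rootP.
by have := max_poly_roots pn0 rs us; rewrite size_map size_iota ltnNge sp.
Qed.

Lemma sum_antidiagonal (d N : nat) (F : nat -> nat -> C) : (d < N)%N ->
  \sum_(m < N) \sum_(n < N | (m + n == d)%N) F m n
  = \sum_(m < d.+1) F m (d - m)%N.
Proof.
move=> dN; rewrite (big_ord_widen N (fun m => F m (d - m)%N)) // [RHS]big_mkcond /=.
apply: eq_bigr => m _; case: ifPn => [md|]; last first.
  rewrite -leqNgt => dm; rewrite big1 // => n /eqP mnd.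
  by move: dm; rewrite -mnd -ltn_subRL subnn.
have dmN : (d - m < N)%N by apply: leq_ltn_trans dN; exact: leq_subr.
apply: (big_pred1 (Ordinal dmN)) => n; rewrite /= -val_eqE /=.
by rewrite ltnS in md; rewrite -{1}(subnKC md) eqn_add2l.
Qed.

(** On the ray [z = t r x], [conj w = t r], the part of total degree [d] of a
    series without lower terms scales like [t ^+ d], while the sum of the higher
    terms is at most [t ^+ d.+1] times the bound of absolute convergence at
    [r].  The estimate is on partial sums, so no rearrangement is needed. *)
Lemma double_series_low_degree (al : nat -> nat -> C) (d N : nat) (B r t x : C) :
  (d < N)%N -> 0 <= r -> 0 <= t <= 1 -> 0 <= x <= 1 ->
  (forall m n, (m + n < d)%N -> al m n = 0) ->
  \sum_(m < N) \sum_(n < N) `|(r ^+ m * r ^+ n) * al m n| <= B ->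
  `|t ^+ d * (r ^+ d * \sum_(m < d.+1) al m (d - m)%N * x ^+ m)|
  <= t ^+ d.+1 * B
     + `|\sum_(m < N) \sum_(n < N) ((t * r * x) ^+ m * (t * r) ^+ n) * al m n|.
Proof.
move=> dN r0 /andP[t0 t1] /andP[x0 x1] al0 alB.
pose T m n := ((t * r * x) ^+ m * (t * r) ^+ n) * al m n.
pose hi := \sum_(m < N) \sum_(n < N | (m + n != d)%N) T m n.
have -> : t ^+ d * (r ^+ d * \sum_(m < d.+1) al m (d - m)%N * x ^+ m)
          = (\sum_(m < N) \sum_(n < N) T m n) - hi.
  have -> : \sum_(m < N) \sum_(n < N) T m n
      = (\sum_(m < N) \sum_(n < N | (m + n == d)%N) T m n) + hi.
    rewrite -big_split /=; apply: eq_bigr => m _.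
    by rewrite (bigID (fun n : 'I_N => m + n == d)%N).
  rewrite addrK sum_antidiagonal // mulrA mulr_sumr.
  apply: eq_bigr => m _; rewrite /T.
  have md : (m <= d)%N by rewrite -ltnS.
  rewrite -{1 2}(subnKC md) !exprD !exprMn; ring.
apply: (le_trans (ler_normB _ _)); rewrite addrC lerD2r /hi.
apply: (@le_trans _ _ (t ^+ d.+1 *
     \sum_(m < N) \sum_(n < N) `|(r ^+ m * r ^+ n) * al m n|)); last first.
  by rewrite ler_wpM2l ?exprn_ge0.
apply: (le_trans (ler_norm_sum _ _ _)); rewrite mulr_sumr.
apply: ler_sum => m _; rewrite mulr_sumr big_mkcond /=.
apply: (le_trans (ler_norm_sum _ _ _)); apply: ler_sum => n _.
case: ifPn => [mnd|_]; last by rewrite normr0 mulr_ge0 ?exprn_ge0.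
have [lt|ge] := ltnP (m + n) d; first by rewrite /T al0 // !mulr0 normr0 mulr0.
have gt : (d.+1 <= m + n)%N by rewrite ltn_neqAle eq_sym mnd.
rewrite /T !normrM !normrX !normrM mulrA ler_wpM2r // !ger0_norm //.
have -> : (t * r * x) ^+ m * (t * r) ^+ n
   = t ^+ (m + n) * (r ^+ m * r ^+ n) * x ^+ m by rewrite exprD !exprMn; ring.
apply: (@le_trans _ _ (t ^+ (m + n) * (r ^+ m * r ^+ n))).
  by rewrite ler_piMr ?mulr_ge0 ?exprn_ge0 // exprn_ile1.
by rewrite ler_wpM2r ?mulr_ge0 ?exprn_ge0 // ler_wiXn2l.
Qed.

(** Induction on the total degree [d = m + n].  Letting first [N] tend to
    infinity and then [t] to [0] in [double_series_low_degree], the homogeneous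
    part of degree [d] vanishes for all [x] in [[0, 1]]; it is a polynomial in
    [x] with the coefficients [al m (d - m)]. *)
Lemma double_series_coef0 (al : nat -> nat -> C) (rho : C) : 0 < rho ->
  (forall z w : C, `|z| < rho -> `|w| < rho ->
    (exists B : C, forall N, \sum_(m < N) \sum_(n < N)
       `|(z ^+ m * Num.conj w ^+ n) * al m n| <= B) /\
    forall e : C, 0 < e -> exists N0, forall N, (N0 <= N)%N ->
      `|\sum_(m < N) \sum_(n < N) (z ^+ m * Num.conj w ^+ n) * al m n| < e) ->
  forall m n, al m n = 0.
Proof.
move=> rho0 Hal.
suff H d : forall m n, (m + n < d)%N -> al m n = 0.
  by move=> m n; apply: (H (m + n).+1).
elim: d => // d IH m n; rewrite ltnS leq_eqVlt => /orP[/eqP mnd|]; last exact: IH.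
pose r := rho / 2.
have r0 : 0 < r by rewrite divr_gt0 // ltr0n.
have rr : r < rho by rewrite ltr_pdivrMr ?ltr0n // ltr_pMr // (ltr_nat _ 1 2).
have nr : `|r| < rho by rewrite gtr0_norm.
have [[B HB] _] := Hal _ _ nr nr.
have cr : Num.conj r = r by rewrite conj_Creal // gtr0_real.
rewrite cr in HB.
have B0 : 0 <= B by have := HB 0%N; rewrite big_ord0.
have Q0 x : 0 <= x <= 1 -> \sum_(m < d.+1) al m (d - m)%N * x ^+ m = 0.
  move=> x01; set q := \sum_(m < d.+1) _.
  have key t : 0 < t -> t < 1 -> `|r ^+ d * q| <= t * B.
    move=> t0 t1; have td : 0 < t ^+ d by rewrite exprn_gt0.
    rewrite -(ler_pM2l td) mulrA -exprSr -[t ^+ d in leLHS]gtr0_norm // -normrM.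
    have tBr : t ^+ d.+1 * B \is Num.real.
      by rewrite ger0_real // mulr_ge0 // exprn_ge0 // ltW.
    have [//|lt] := real_leP (normr_real _) tBr.
    have e0 : 0 < `|t ^+ d * (r ^+ d * q)| - t ^+ d.+1 * B by rewrite subr_gt0.
    have tr0 : 0 <= t * r by rewrite mulr_ge0 ?ltW.
    have wl : `|t * r| < rho.
      by rewrite ger0_norm //; apply: le_lt_trans rr; rewrite ler_piMl ?ltW.
    have zl : `|t * r * x| < rho.
      move: x01 => /andP[x0 x1]; apply: le_lt_trans wl.
      by rewrite normrM ler_piMr // ger0_norm.
    have [_ /(_ _ e0)[N0 HN]] := Hal _ _ zl wl.
    pose N := maxn N0 d.+1.
    have := HN N (leq_maxl _ _).
    have -> : Num.conj (t * r) = t * r by rewrite conj_Creal // ger0_real.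
    have t01 : 0 <= t <= 1 by rewrite !ltW.
    have := double_series_low_degree (leq_maxr N0 d.+1) (ltW r0) t01 x01 IH (HB N).
    rewrite -/q => h1 h2; have := le_lt_trans h1 (ler_ltD (lexx _) h2).
    by rewrite addrC subrK ltxx.
  have [q0|q0] := eqVneq q 0; first by [].
  have n0 : 0 < `|r ^+ d * q|.
    by rewrite normr_gt0 mulf_neq0 // expf_neq0 // gt_eqF.
  set nq := `|_| in key n0.
  have s0 : 0 < nq + B + 1 by rewrite addr_gt0 // ltr_wpDr.
  (* This [t] is below [1] and makes [t * B] smaller than [nq]. *)
  have := key (nq / (nq + B + 1)) (divr_gt0 n0 s0).
  rewrite ltr_pdivrMr // mul1r => /(_ _).
  have -> : nq < nq + B + 1 by rewrite -addrA ltrDl ltr_wpDl.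
  move=> /(_ isT); rewrite mulrAC ler_pdivlMr // ler_pM2l //.
  rewrite addrAC gerDr => /(lt_le_trans _) lt0.
  by have := lt0 _ (addr_gt0 n0 ltr01); rewrite ltxx.
pose p := \poly_(m < d.+1) al m (d - m)%N.
have p0 : p = 0.
  apply: (@poly_zero_of_values d.+1); first exact: size_poly.
  move=> j; rewrite horner_poly Q0 // invr_ge0 ler0n /=.
  by rewrite invf_le1 ?ltr0n // ler1n.
have := coef_poly d.+1 (fun m => al m (d - m)%N) m; rewrite -/p p0 coef0.
by rewrite -mnd ltnS leq_addr addKn.
Qed.

End DoubleSeries.

(** * Neumann series *)

Section Neumann.
Variables (R : realType) (k : R[i] -> R[i] -> R[i]) (H : rkhs k).
Local Notation C := R[i].
Implicit Types (u v w h : H) (T S Z Y : H -> H) (c q : C).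

Lemma norm_iter_le Z q n h : 0 <= q -> (forall u, `|Z u| <= q * `|u|) ->
  `|iter n Z h| <= q ^+ n * `|h|.
Proof.
move=> q0 Zq; elim: n => [|n IH]; first by rewrite expr0 mul1r.
by apply: (le_trans (Zq _)); rewrite exprS -mulrA ler_wpM2l.
Qed.

Lemma geometric_sum_le q n : 0 <= q -> q < 1 ->
  \sum_(0 <= i < n) q ^+ i <= (1 - q)^-1.
Proof.
move=> q0 q1; have q'0 : 0 < 1 - q by rewrite subr_gt0.
rewrite -[leRHS]mul1r ler_pdivlMr // mulrC.
have -> : (1 - q) * \sum_(0 <= i < n) q ^+ i = 1 - q ^+ n.
  by rewrite big_mkord -opprB mulNr -subrX1 opprB.
by rewrite gerBl exprn_ge0.
Qed.

Lemma geometric_cvg0 (u : nat -> H) q (b : C) : 0 <= q -> q < 1 ->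
  (forall n, `|u n| <= q ^+ n * b) -> u @ \oo --> (0 : H).
Proof.
move=> q0 q1 ub.
have b0 : 0 <= b.
  by have := le_trans (normr_ge0 _) (ub 0%N); rewrite expr0 mul1r.
have ReE (x : C) : 0 <= x -> x = (complex.Re x)%:C%C.
  by move=> x0; rewrite RRe_real // ger0_real.
have qlt : `|complex.Re q| < 1.
  by rewrite ger0_norm -?ltcR -?lecR -?ReE.
apply/cvgrPdist_lt => e e0.
have e'0 : 0 < complex.Re e by rewrite -ltcR -ReE // ltW.
have := cvg_geometric (complex.Re b) qlt.
move=> /cvgrPdist_lt/(_ _ e'0)[N _ HN]; exists N => // n /HN /=.
rewrite sub0r normrN sub0r normrN => lt; apply: (le_lt_trans (ub n)).
rewrite (ReE q) // (ReE b) // (ReE e) ?(ltW e0) // -rmorphXn -rmorphM ltcR.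
by apply: le_lt_trans lt; rewrite /geometric /= mulrC ler_norm.
Qed.

(** The sum [S h] of the [Z^n h] satisfies [S h = h + Z (S h)]; linearity of [S]
    and the identity on the other side both follow from injectivity of
    [id - Z]. *)
Lemma neumann Z q : bounded_op Z -> 0 <= q -> q < 1 ->
  (forall u, `|Z u| <= q * `|u|) -> exists S, is_op_inv (fun h => h - Z h) S.
Proof.
move=> bZ q0 q1 Zq; have q'0 : 0 < 1 - q by rewrite subr_gt0.
have bI := bounded_op_sub bZ.
have iq0 : 0 <= (1 - q)^-1 by rewrite invr_ge0 ltW.
pose t h : C := (1 - q)^-1 * `|h|.
have t0 h : 0 <= t h by rewrite mulr_ge0.
pose s h N := \sum_(0 <= i < N) iter i Z h.
have sle h m n : `|\sum_(m <= i < n) iter i Z h| <=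
    \sum_(m <= i < n) q ^+ i * `|h|.
  apply: (le_trans (ler_norm_sum _ _ _)); apply: ler_sum => i _.
  exact: norm_iter_le.
have gt h n : \sum_(0 <= i < n) q ^+ i * `|h| <= t h.
  by rewrite -mulr_suml ler_wpM2r // geometric_sum_le.
have cs h : cvgn (s h).
  pose g N := complex.Re (t h * \sum_(0 <= i < N) q ^+ i * `|h|).
  have gE N : (g N)%:C%C = t h * \sum_(0 <= i < N) q ^+ i * `|h|.
    rewrite RRe_real // ger0_real // mulr_ge0 // sumr_ge0 // => i _.
    by rewrite mulr_ge0 // exprn_ge0.
  apply: (@cvg_of_real_gauge _ _ _ _ g (complex.Re (t h * t h))) => [m n mn|n].
    rewrite rmorphB /= !gE -mulrBr.
    have -> : s h n - s h m = \sum_(m <= i < n) iter i Z h.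
      by rewrite /s (@big_cat_nat _ _ _ m 0 n) //= addrAC subrr add0r.
    have -> : \sum_(0 <= i < n) q ^+ i * `|h| - \sum_(0 <= i < m) q ^+ i * `|h|
        = \sum_(m <= i < n) q ^+ i * `|h|.
      by rewrite (@big_cat_nat _ _ _ m 0 n) //= addrAC subrr add0r.
    rewrite expr2 ler_pM // ?sle //; apply: (le_trans (sle _ _ _)).
    apply: le_trans (gt h n); rewrite (@big_cat_nat _ _ _ m 0 n) //= lerDr.
    by rewrite sumr_ge0 // => i _; rewrite mulr_ge0 // exprn_ge0.
  rewrite -lecR gE RRe_real ?ger0_real ?mulr_ge0 //.
  by rewrite ler_wpM2l.
pose S h := limn (s h).
have Sb h : `|S h| <= (1 - q)^-1 * `|h|.
  by apply: norm_cvg_le (cs h) _ => n; apply: (le_trans (sle _ _ _)).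
have ST h : S h - Z (S h) = h.
  have l1 : (fun n => s h n.+1) @ \oo --> S h by rewrite cvg_shiftS; exact: cs.
  have l2 : (fun n => h + Z (s h n)) @ \oo --> h + Z (S h).
    by apply: cvgD; [exact: cvg_cst | apply: bounded_op_cvg => //; exact: cs].
  have E : (fun n => s h n.+1) = (fun n => h + Z (s h n)).
    apply/funext => n; rewrite /s big_nat_recl //=; congr (_ + _).
    by rewrite bounded_op_sum.
  rewrite E in l1.
  by rewrite {1}(cvg_unique (@norm_hausdorff _ H) l1 l2) addrK.
have inj h g : h - Z h = g - Z g -> h = g.
  move=> hg; have d : h - g = Z (h - g).
    have -> : Z (h - g) = Z h - Z g.
      by rewrite bounded_opD // -scaleN1r bounded_opZ // scaleN1r.
    by rewrite -[h in LHS](subrK (Z h)) hg addrC !addrA addNr add0r addrC.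
  apply/eqP; rewrite -subr_eq0 -normr_eq0 -[_ == 0]negbK; apply/negP => n0.
  have np : 0 < `|h - g| by rewrite lt_def n0 normr_ge0.
  have := Zq (h - g); rewrite -d -[leLHS]mul1r ler_pM2r //.
  by move=> /(lt_le_trans q1); rewrite ltxx.
exists S; split.
- apply: (bounded_opI (c := (1 - q)^-1)) => // a u v.
  apply: inj; rewrite ST -{1}(ST u) -{1}(ST v).
  by have := bI.1 a (S u) (S v) => ->.
- by apply/funext => h /=; apply: inj; rewrite ST.
- by apply/funext => h /=; rewrite ST.
Qed.

Lemma neumann_partial_sum Z S n h : bounded_op Z ->
  is_op_inv (fun h => h - Z h) S ->
  \sum_(0 <= i < n) iter i Z h = S (h - iter n Z h).
Proof.
move=> bZ [bS SZ _].
have : \sum_(0 <= i < n) iter i Z h - Z (\sum_(0 <= i < n) iter i Z h)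
    = h - iter n Z h.
  rewrite bounded_op_sum // -sumrB.
  elim: n => [|n IH]; first by rewrite big_geq //= subrr.
  by rewrite big_nat_recr //= IH addrA subrK.
by move=> <-; have /= -> := congr1 (@^~ (\sum_(0 <= i < n) iter i Z h)) SZ.
Qed.

(** The square partial sums are [S (s N - Z^N (s N))], where
    [s N = S' (h - Y^N h)]; both remainders decay geometrically, so continuity of
    the two resolvents suffices. *)
Lemma double_neumann_cvg Z Y S S' q h : bounded_op Z -> bounded_op Y ->
  0 <= q -> q < 1 -> (forall u, `|Z u| <= q * `|u|) ->
  (forall u, `|Y u| <= q * `|u|) ->
  is_op_inv (fun h => h - Z h) S -> is_op_inv (fun h => h - Y h) S' ->
  (fun N : nat => \sum_(m < N) \sum_(n < N) iter m Z (iter n Y h)) @ \oo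
    --> S (S' h).
Proof.
move=> bZ bY q0 q1 Zq Yq ZS YS.
have biter n : bounded_op (iter n Z).
  by elim: n => [|n IH]; [exact: bounded_op_id | exact: (bounded_op_comp bZ IH)].
pose s N := \sum_(0 <= n < N) iter n Y h.
have sE N : s N = S' (h - iter N Y h) by exact: neumann_partial_sum.
have sl : s @ \oo --> S' h.
  rewrite (funext sE); apply: bounded_op_cvg; first by case: YS.
  rewrite -[h in _ --> h]subr0; apply: cvgB; first exact: cvg_cst.
  by apply: (geometric_cvg0 q0 q1 (b := `|h|)) => n; exact: norm_iter_le.
have [b b0 sb] : exists2 b : C, 0 <= b & forall n, `|s n| <= b.
  exists ((1 - q)^-1 * `|h|).
    by rewrite mulr_ge0 // invr_ge0 subr_ge0 ltW.
  move=> n; apply: (le_trans (ler_norm_sum _ _ _)).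
  apply: (@le_trans _ _ (\sum_(0 <= i < n) q ^+ i * `|h|)).
    by apply: ler_sum => i _; exact: norm_iter_le.
  by rewrite -mulr_suml ler_wpM2r // geometric_sum_le.
have E : (fun N : nat => \sum_(m < N) \sum_(n < N) iter m Z (iter n Y h))
    = (fun N => S (s N - iter N Z (s N))).
  apply/funext => N; rewrite -(neumann_partial_sum _ _ bZ ZS) big_mkord.
  by apply: eq_bigr => m _; rewrite /s big_mkord bounded_op_sum.
rewrite E; apply: bounded_op_cvg; first by case: ZS.
rewrite -[X in _ --> X]subr0; apply: cvgB => //.
apply: (geometric_cvg0 q0 q1 (b := b)) => n.
apply: (le_trans (norm_iter_le _ _ q0 Zq)).
by rewrite ler_wpM2l // exprn_ge0.
Qed.

End Neumann.

(** * Expansions of operator-valued kernels *)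

Section KernelExpansions.
Variables (R : realType) (k : R[i] -> R[i] -> R[i]) (H : rkhs k).
Local Notation C := R[i].
Implicit Types (u v h g : H) (T S L P : H -> H).

(** For [`|l| > c] the Neumann series inverts [id - l^-1 T]. *)
Lemma spectral_radius_le T (c : C) : bounded_op T -> 0 <= c ->
  (forall h, `|T h| <= c * `|h|) -> (spectral_radius T <= (complex.Re c)%:E)%E.
Proof.
move=> bT c0 Tc; apply: ge_ereal_sup => _ [l lT <-].
rewrite lee_fin leNgt; apply/negP => cl; apply: lT.
have cE : c = (complex.Re c)%:C%C by rewrite RRe_real // ger0_real.
have cl' : c < `|l| by rewrite cE; change (`|l|) with (Normc.normc l)%:C%C; rewrite ltcR.
have l0 : 0 < `|l| by exact: le_lt_trans cl'.
have ln0 : l != 0 by rewrite -normr_gt0.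
have [S [bS SZ ZS]] : exists S, is_op_inv (fun h => h - l^-1 *: T h) S.
  apply: (neumann (q := c / `|l|)); first exact: bounded_op_scale.
  - by rewrite divr_ge0.
  - by rewrite ltr_pdivrMr // mul1r.
  - by move=> u; rewrite normrZ normfV [c / _]mulrC -mulrA ler_wpM2l ?invr_ge0.
exists (fun h => l^-1 *: S h); split.
- exact: bounded_op_scale.
- apply/funext => h /=; rewrite -bounded_opZ //.
  rewrite scalerBr scalerA mulVf // scale1r.
  exact: (congr1 (@^~ h) SZ).
- apply/funext => h /=; rewrite scalerA mulfV // scale1r.
  by rewrite bounded_opZ //; exact: (congr1 (@^~ h) ZS).
Qed.

Lemma sa_disc_ball T : bounded_op (sa_left_inv T) ->
  exists2 rho : C, 0 < rho & forall z : C, `|z| < rho -> sa_disc T z.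
Proof.
move=> bL; have [c c0 Lc] := bounded_op_bound bL.
have c1 : 0 < c + 1 by rewrite ltr_wpDl.
exists (c + 1)^-1 => [|z zl]; first by rewrite invr_gt0.
have sr := spectral_radius_le bL c0 Lc.
apply: (@le_lt_trans _ _ ((Normc.normc z)%:E * (complex.Re c)%:E)%E).
  by apply: lee_wpmul2l => //; rewrite lee_fin -lecR; exact: (normr_ge0 z).
rewrite -EFinM lte_fin -ltcR rmorphM /= RRe_real ?ger0_real //.
change ((Normc.normc z)%:C%C) with (`|z|).
apply: (@le_lt_trans _ _ ((c + 1)^-1 * c)); first by rewrite ler_wpM2r // ltW.
by rewrite mulrC ltr_pdivrMr // mul1r ltrDl.
Qed.

Lemma sum_norm_geometric_le (t : nat -> nat -> C) (b : C) (N : nat) : 0 <= b ->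
  (forall m n, t m n <= 2^-1 ^+ m * (2^-1 ^+ n * b)) ->
  \sum_(m < N) \sum_(n < N) t m n <= 2 * (2 * b).
Proof.
move=> b0 tb.
have half0 : 0 <= 2^-1 :> C by rewrite invr_ge0 ler0n.
have half1 : 2^-1 < 1 :> C by rewrite invf_lt1 ?ltr0n // (ltr_nat _ 1 2).
have halfE : (1 - 2^-1)^-1 = 2 :> C by field.
have gs n : \sum_(i < n) (2^-1 : C) ^+ i <= 2.
  by rewrite -[leRHS]halfE; have := geometric_sum_le n half0 half1; rewrite big_mkord.
apply: (@le_trans _ _ (\sum_(m < N) 2^-1 ^+ m * (2 * b))); last first.
  by rewrite -mulr_suml ler_wpM2r // mulr_ge0.
apply: ler_sum => m _.
apply: (@le_trans _ _ (\sum_(n < N) 2^-1 ^+ m * (2^-1 ^+ n * b))).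
  by apply: ler_sum => n _.
by rewrite -mulr_sumr ler_wpM2l ?exprn_ge0 // -mulr_suml ler_wpM2r.
Qed.

(** Both resolvents are Neumann series as soon as [z *: L] and [conj w *: L']
    have norm at most one half, and then the double series is dominated by a
    product of two geometric series. *)
Lemma kernel_expansion_resolvents (W : set H) (D : set C) P L (L' : H -> H) :
  bounded_op P -> bounded_op L -> bounded_op L' -> (forall h, W (P h)) ->
  (exists2 rho : C, 0 < rho & forall z : C, `|z| < rho -> D z) ->
  kernel_expansion W D
    (fun z w => P \o op_inv (fun h => h - z *: L h)
                  \o op_inv (fun h => h - Num.conj w *: L' h))
    (fun m n => P \o iter m L \o iter n L').
Proof.
move=> bP bL bL' WP [r0 r0p rD]; split=> [m n|].
  split=> [|h _]; last exact: WP.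
  apply: bounded_op_comp; last exact: bounded_op_iter.
  by apply: bounded_op_comp => //; exact: bounded_op_iter.
have [p p0 Pp] := bounded_op_bound bP.
have [c1 c10 Lc] := bounded_op_bound bL.
have [c2 c20 Lc'] := bounded_op_bound bL'.
have half0 : 0 <= 2^-1 :> C by rewrite invr_ge0 ler0n.
have half1 : 2^-1 < 1 :> C by rewrite invf_lt1 ?ltr0n // (ltr_nat _ 1 2).
(* The radius [s^-1] is at most [r0], and [s^-1 * ci] is at most one half. *)
pose s := r0^-1 + 2 * (c1 + c2).
have s0 : 0 < s by rewrite ltr_wpDr ?invr_gt0 // mulr_ge0 // addr_ge0.
have small T c (z : C) : 0 <= c -> (forall h, `|T h| <= c * `|h|) ->
    c <= c1 + c2 -> `|z| < s^-1 -> forall h, `|z *: T h| <= 2^-1 * `|h|.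
  move=> cc0 Tc cs zs h; rewrite normrZ.
  apply: (le_trans (ler_wpM2l (normr_ge0 z) (Tc h))).
  rewrite mulrA ler_wpM2r //.
  apply: (@le_trans _ _ (s^-1 * c)); first by rewrite ler_wpM2r // ltW.
  rewrite mulrC ler_pdivrMr // mulrC ler_pdivlMr ?ltr0n // mulrC.
  rewrite /s; apply: (@le_trans _ _ (2 * (c1 + c2))).
    by rewrite ler_wpM2l.
  by rewrite lerDr invr_ge0 ltW.
exists s^-1; split; first by rewrite invr_gt0.
  move=> z zs; apply: rD; apply: (lt_le_trans zs).
  rewrite -[leRHS]invrK lef_pV2 ?posrE ?invr_gt0 //.
  by rewrite lerDl mulr_ge0 // addr_ge0.
move=> z w h zs ws _ t.
have Zq : forall u, `|z *: L u| <= 2^-1 * `|u|.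
  by apply: (small _ c1) => //; rewrite lerDl.
have Yq : forall u, `|Num.conj w *: L' u| <= 2^-1 * `|u|.
  by apply: (small _ c2) => //; rewrite ?norm_conjC // lerDr.
have bZ := bounded_op_scale z bL; have bY := bounded_op_scale (Num.conj w) bL'.
have [S HS] := neumann bZ half0 half1 Zq.
have [S' HS'] := neumann bY half0 half1 Yq.
have tE m n : t m n = P (iter m (fun h => z *: L h)
                           (iter n (fun h => Num.conj w *: L' h) h)).
  rewrite iter_scale // iter_scale // (bounded_opZ _ _ (bounded_op_iter _ bL)).
  by rewrite scalerA bounded_opZ.
split.
  exists (2 * (2 * (p * `|h|))) => N; apply: (@sum_norm_geometric_le (fun m n => `|t m n|)).
    by rewrite mulr_ge0.
  move=> m n; rewrite tE; apply: (le_trans (Pp _)).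
  rewrite [_ * (p * _)]mulrCA [_ * (p * _)]mulrCA ler_wpM2l //.
  apply: (le_trans (norm_iter_le _ _ half0 Zq)); rewrite ler_wpM2l ?exprn_ge0 //.
  exact: norm_iter_le.
rewrite /= (op_inv_eq HS) (op_inv_eq HS').
have lim := bounded_op_cvg bP (double_neumann_cvg (h := h) bZ bY half0 half1 Zq Yq HS HS').
suff -> : (fun N : nat => \sum_(m < N) \sum_(n < N) t m n)
  = (fun N : nat => P (\sum_(m < N) \sum_(n < N)
       iter m (fun h => z *: L h) (iter n (fun h => Num.conj w *: L' h) h))) by [].
apply/funext => N; rewrite bounded_op_sum //; apply: eq_bigr => m _.
by rewrite bounded_op_sum //; apply: eq_bigr => n _; rewrite tE.
Qed.

(** Pairing with an arbitrary vector reduces to scalar double series. *)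
Lemma kernel_expansion_unique (W : set H) (D : set C) K A B m n h :
  kernel_expansion W D K A -> kernel_expansion W D K B -> W h ->
  A m n h = B m n h.
Proof.
move=> [_ [r1 [r10 _ HA]]] [_ [r2 [r20 _ HB]]] Wh.
pose r := (r1^-1 + r2^-1)^-1.
have r0 : 0 < r by rewrite invr_gt0 addr_gt0 // invr_gt0.
have rr1 : r <= r1.
  by rewrite -[leRHS]invrK lef_pV2 ?posrE ?addr_gt0 ?invr_gt0 // lerDl invr_ge0 ltW.
have rr2 : r <= r2.
  by rewrite -[leRHS]invrK lef_pV2 ?posrE ?addr_gt0 ?invr_gt0 // lerDr invr_ge0 ltW.
apply: ip_extl => g; apply/eqP; rewrite -subr_eq0; apply/eqP.
apply: (@double_series_coef0 _ (fun m n => ip (A m n h) g - ip (B m n h) g) r) => //.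
move=> z w zr wr.
have [[BA HBA] cA] := HA z w h (lt_le_trans zr rr1) (lt_le_trans wr rr1) Wh.
have [[BB HBB] cB] := HB z w h (lt_le_trans zr rr2) (lt_le_trans wr rr2) Wh.
split.
  exists ((BA + BB) * `|g|) => N.
  have g0 : 0 <= `|g| by [].
  apply: (@le_trans _ _ (\sum_(m < N) \sum_(n < N)
     (`|(z ^+ m * Num.conj w ^+ n) *: A m n h|
      + `|(z ^+ m * Num.conj w ^+ n) *: B m n h|) * `|g|)).
    apply: ler_sum => i _; apply: ler_sum => j _.
    rewrite mulrBr -!ipZl mulrDl.
    by apply: (le_trans (ler_normB _ _)); apply: lerD; exact: cauchy_schwarz.
  under eq_bigr do rewrite -mulr_suml.
  rewrite -mulr_suml ler_wpM2r //.
  under eq_bigr do rewrite big_split /=.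
  by rewrite big_split /=; apply: lerD; [exact: HBA | exact: HBB].
move=> e e0.
have g1 : 0 < `|g| + 1 by rewrite ltr_wpDl.
have lim0 : (fun N : nat =>
    \sum_(m < N) \sum_(n < N) (z ^+ m * Num.conj w ^+ n) *: A m n h
    - \sum_(m < N) \sum_(n < N) (z ^+ m * Num.conj w ^+ n) *: B m n h) @ \oo
    --> (0 : H).
  by rewrite -[X in _ --> X](subrr (K z w h)); apply: cvgB; [exact: cA | exact: cB].
move/cvgrPdist_lt: lim0 => /(_ _ (divr_gt0 e0 g1)).
move=> [N0 _ HN]; exists N0 => N /HN /=; rewrite sub0r normrN => lt.
have -> : \sum_(m < N) \sum_(n < N)
    (z ^+ m * Num.conj w ^+ n) * (ip (A m n h) g - ip (B m n h) g) =
  ip (\sum_(m < N) \sum_(n < N) (z ^+ m * Num.conj w ^+ n) *: A m n h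
     - \sum_(m < N) \sum_(n < N) (z ^+ m * Num.conj w ^+ n) *: B m n h) g.
  rewrite linearBl /= !ip_suml -sumrB; apply: eq_bigr => i _.
  rewrite !ip_suml -sumrB; apply: eq_bigr => j _.
  by rewrite mulrBr !ipZl.
apply: (le_lt_trans (cauchy_schwarz _ _)).
apply: (@le_lt_trans _ _ (e / (`|g| + 1) * `|g|)); first by rewrite ler_wpM2r // ltW.
by rewrite mulrAC ltr_pdivrMr // ltr_pM2l // ltrDl.
Qed.

End KernelExpansions.

(** * The Shimorin-Aluthge kernel of a left-invertible operator *)

Section ShimorinAluthge.
Variables (R : realType) (k : R[i] -> R[i] -> R[i]) (H : rkhs k).
Local Notation C := R[i].
Implicit Types (u v h g : H) (T S L P : H -> H).

Lemma iter_adjoint T S n : (forall u v, ip (T u) v = ip u (S v)) ->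
  forall u v, ip (iter n T u) v = ip u (iter n S v).
Proof. by move=> TS; elim: n => // n IH u v; rewrite iterS TS IH -iterSr. Qed.

(** In this section [M* M] is diagonal in some orthonormal basis with eigenvalues
    bounded away from zero, and the kernel of [M*] is spanned by a unit vector
    [f0] that is an eigenvector of [M* M].  Hence [D = |M|] and [Q = |M|^(1/2)]
    are diagonal as well and fix the line of [f0]. *)
Variables (M : H -> H) (e : nat -> H) (lam : nat -> C) (b : C) (f0 : H) (alpha : C).
Hypotheses (bM : bounded_op M) (eB : orthonormal_basis e).
Hypotheses (Ae : diagonal_op e lam (adjoint M \o M)) (lam0 : forall n, 0 < lam n).
Hypothesis lamV : forall n, `|(lam n)^-1| <= b.
Hypotheses (f0_unit : ip f0 f0 = 1) (Mf0 : adjoint M f0 = 0).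
Hypothesis kerM : forall h, adjoint M h = 0 -> h = ip h f0 *: f0.
Hypotheses (alpha0 : 0 < alpha) (Af0 : adjoint M (M f0) = alpha *: f0).

Let A := adjoint M \o M.
Let D := op_abs M.
Let Q := op_sqrt D.
Let B := shimorin_inv M.
Let d n := sqrtC (lam n).
Let q n := sqrtC (d n).

Let d0 n : 0 < d n. Proof. by rewrite sqrtC_gt0. Qed.
Let q0 n : 0 < q n. Proof. by rewrite sqrtC_gt0. Qed.

Let absP : [/\ diagonal_op e d D, positive_op D & D \o D = A].
Proof. exact: (op_sqrt_diagonal eB Ae lam0). Qed.

Let sqrtP : [/\ diagonal_op e q Q, positive_op Q & Q \o Q = D].
Proof. by apply: (op_sqrt_diagonal eB _ d0); case: absP. Qed.

Let De : diagonal_op e d D. Proof. by case: absP. Qed.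
Let Qe : diagonal_op e q Q. Proof. by case: sqrtP. Qed.

Lemma invertible_diagonal (c : nat -> C) T : diagonal_op e c T ->
  (forall n, 0 < c n) -> (exists b', forall n, `|(c n)^-1| <= b') ->
  diagonal_op e (fun n => (c n)^-1) (op_inv T) /\ is_op_inv T (op_inv T).
Proof.
move=> Tc c0 [b' cb]; have [S Sc] := diagonal_op_exists eB cb.
have TS : is_op_inv T S.
  by apply: (diagonal_op_inv eB Tc Sc) => n; rewrite divff // gt_eqF.
by rewrite (op_inv_eq TS).
Qed.

Let sqrt_inv_bound (c : nat -> C) : (forall n, 0 < c n) ->
  (exists b', forall n, `|(c n)^-1| <= b') ->
  exists b', forall n, `|(sqrtC (c n))^-1| <= b'.
Proof.
move=> c0 [b' cb]; exists (sqrtC b') => n.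
have cV0 : 0 <= (c n)^-1 by rewrite invr_ge0 ltW.
rewrite ger0_norm ?invr_ge0 ?sqrtC_ge0 ?(ltW (c0 n)) //.
have b'0 : 0 <= b' by apply: le_trans (cb n).
rewrite -(@ler_pXn2r _ 2) ?nnegrE ?invr_ge0 ?sqrtC_ge0 ?(ltW (c0 n)) //.
by rewrite exprVn !sqrtCK -[leLHS]ger0_norm.
Qed.

Let db : exists b', forall n, `|(d n)^-1| <= b'.
Proof. by apply: sqrt_inv_bound => //; exists b. Qed.
Let qb : exists b', forall n, `|(q n)^-1| <= b'.
Proof. exact: sqrt_inv_bound. Qed.

Let Ai := op_inv A.
Let Di := op_inv D.
Let Qi := op_inv Q.

Let AiP : diagonal_op e (fun n => (lam n)^-1) Ai /\ is_op_inv A Ai.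
Proof. by apply: invertible_diagonal => //; exists b. Qed.
Let DiP : diagonal_op e (fun n => (d n)^-1) Di /\ is_op_inv D Di.
Proof. exact: invertible_diagonal. Qed.
Let QiP : diagonal_op e (fun n => (q n)^-1) Qi /\ is_op_inv Q Qi.
Proof. exact: invertible_diagonal. Qed.

Let AiK h : Ai (A h) = h. Proof. by case: AiP => _ [_ /(congr1 (@^~ h))]. Qed.
Let AKi h : A (Ai h) = h. Proof. by case: AiP => _ [_ _ /(congr1 (@^~ h))]. Qed.
Let DiK h : Di (D h) = h. Proof. by case: DiP => _ [_ /(congr1 (@^~ h))]. Qed.
Let DKi h : D (Di h) = h. Proof. by case: DiP => _ [_ _ /(congr1 (@^~ h))]. Qed.
Let QiK h : Qi (Q h) = h. Proof. by case: QiP => _ [_ /(congr1 (@^~ h))]. Qed.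
Let QKi h : Q (Qi h) = h. Proof. by case: QiP => _ [_ _ /(congr1 (@^~ h))]. Qed.
Let DD h : D (D h) = A h. Proof. by case: absP => _ _ /(congr1 (@^~ h)). Qed.
Let QQ h : Q (Q h) = D h. Proof. by case: sqrtP => _ _ /(congr1 (@^~ h)). Qed.
Let DiQ h : Di (Q h) = Qi h. Proof. by rewrite -{1}(QKi h) QQ DiK. Qed.
Let QiQi h : Qi (Qi h) = Di h. Proof. by rewrite -{1}(DKi h) -QQ !QiK. Qed.

Let bD : bounded_op D. Proof. by case: De. Qed.
Let bQ : bounded_op Q. Proof. by case: Qe. Qed.
Let bDi : bounded_op Di. Proof. by case: DiP => -[]. Qed.
Let bQi : bounded_op Qi. Proof. by case: QiP => -[]. Qed.
Let bMs : bounded_op (adjoint M). Proof. exact: (bounded_op_adjoint eB). Qed.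
Let bB : bounded_op B.
Proof. by apply: bounded_op_comp => //; case: AiP => -[]. Qed.

Let symD u v : ip (D u) v = ip u (D v).
Proof. by apply: (diagonal_op_sym eB De) => n; rewrite gtr0_real. Qed.
Let symQ u v : ip (Q u) v = ip u (Q v).
Proof. by apply: (diagonal_op_sym eB Qe) => n; rewrite gtr0_real. Qed.
Let symQi u v : ip (Qi u) v = ip u (Qi v).
Proof.
by apply: (diagonal_op_sym eB QiP.1) => n; rewrite gtr0_real // invr_gt0.
Qed.

Lemma abs_inv_sym u v : ip (op_inv (op_abs M) u) v = ip u (op_inv (op_abs M) v).
Proof.
by apply: (diagonal_op_sym eB DiP.1) => n; rewrite gtr0_real // invr_gt0.
Qed.

Lemma bounded_abs_inv : bounded_op (op_inv (op_abs M)).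
Proof. exact: bDi. Qed.

Lemma abs_inv_eigen h (c : C) : 0 < c -> adjoint M (M h) = c *: h ->
  op_inv (op_abs M) h = (sqrtC c)^-1 *: h.
Proof.
move=> c0 Ah; have Dh : D h = sqrtC c *: h.
  by apply: positive_op_sqr_eigen => //; [case: absP | rewrite DD].
have s0 : sqrtC c != 0 by rewrite sqrtC_eq0 gt_eqF.
by rewrite -[in LHS](scalerK s0 h) -/D -/Di bounded_opZ // -Dh DiK.
Qed.

Lemma bounded_shimorin_inv : bounded_op (shimorin_inv M).
Proof. exact: bB. Qed.

Lemma shimorin_invK h : shimorin_inv M (M h) = h.
Proof. exact: AiK. Qed.

Lemma shimorin_inv_kernel : shimorin_inv M f0 = 0.
Proof. by rewrite /shimorin_inv /= Mf0 -/A -/Ai (bounded_op0 AiP.1.1). Qed.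

(** [M B] is the orthogonal projection onto the range of [M], the complement of
    [f0]. *)
Let MB h : M (B h) = h - ip h f0 *: f0.
Proof.
have Ms0 : adjoint M (M (B h) - h) = 0.
  rewrite bounded_opD // -scaleN1r bounded_opZ // scaleN1r.
  by rewrite -[adjoint M (M _)]/(A (Ai (adjoint M h))) AKi subrr.
have MBf : ip (M (B h)) f0 = 0 by rewrite (adjointP eB) // Mf0 linear0r.
have := kerM Ms0; rewrite linearBl /= MBf sub0r scaleNr => E.
by rewrite -[LHS](subrK h) E addrC.
Qed.

Let dd : C := sqrtC alpha.
Let qq : C := sqrtC dd.
Let dd0 : 0 < dd. Proof. by rewrite sqrtC_gt0. Qed.
Let qq0 : 0 < qq. Proof. by rewrite sqrtC_gt0. Qed.

Let Df0 : D f0 = dd *: f0.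
Proof. by apply: positive_op_sqr_eigen => //; [case: absP | rewrite DD]. Qed.
Let Qf0 : Q f0 = qq *: f0.
Proof. by apply: positive_op_sqr_eigen => //; [case: sqrtP | rewrite QQ]. Qed.
Let Dif0 : Di f0 = dd^-1 *: f0.
Proof. exact: abs_inv_eigen. Qed.

(** As [D] is invertible, [U D = M] forces [U = M D^-1], an isometry because
    [M* M = D^2]. *)
Let polarE : polar_isometry M = M \o Di.
Proof.
rewrite /polar_isometry; set X := [set U | _].
have Minj h : M h = 0 -> h = 0.
  by move=> Mh; rewrite -(shimorin_invK h) Mh; exact: (bounded_op0 bB).
have [_ UD _] : X (get X).
  apply: getPex; exists (M \o Di); split.
  - split; first exact: bounded_op_comp.
    move=> h _; apply/eqP; rewrite -(@eqrXn2 _ 2) // -!ip_norm /=.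
    rewrite (adjointP eB) // -[adjoint M _]/(A (Di h)) -DD DKi.
    by rewrite -symD DKi.
  - by apply/funext => h /=; rewrite -/D DiK.
  - apply/seteqP; split=> h /=; rewrite /op_ker /= => Mh.
      by rewrite -(DKi h) (Minj _ Mh) (bounded_op0 bD) (bounded_op0 bM).
    by rewrite (Minj _ Mh) (bounded_op0 bDi) (bounded_op0 bM).
by apply/funext => h; rewrite -[in LHS](DKi h) -/D; exact: (congr1 (@^~ (Di h)) UD).
Qed.

(** [M D^-1] sandwiched between copies of [Q] is similar to [M] through [Q]. *)
Let aluE : aluthge M = Q \o M \o Qi.
Proof. by apply/funext => h; rewrite /aluthge polarE /= -/D -/Q DiQ. Qed.

Let alu_adj : adjoint (aluthge M) = Qi \o adjoint M \o Q.
Proof.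
apply: adjoint_eq => g h; rewrite aluE /= symQ (adjointP eB) // symQi //.
Qed.

Lemma sa_wanderingE h : sa_wandering M h <-> h = ip h f0 *: f0.
Proof.
rewrite /sa_wandering /op_ker /= alu_adj /=; split=> [E|->]; last first.
  rewrite (bounded_opZ _ _ bQ) Qf0 !(bounded_opZ _ _ bMs) Mf0 !scaler0.
  exact: bounded_op0.
have /kerM : adjoint M (Q h) = 0 by rewrite -[LHS]QKi E (bounded_op0 bQ).
rewrite symQ Qf0 ipZr conj_Creal ?gtr0_real // mulrC -scalerA -Qf0.
rewrite -(bounded_opZ _ _ bQ) => /(congr1 Qi); by rewrite !QiK.
Qed.

Lemma orth_proj_wandering :
  orth_proj (sa_wandering M) = (fun h => ip h f0 *: f0).
Proof.
rewrite /orth_proj; set X := [set P : H -> H | _].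
have XP : X (get X).
  apply: getPex; exists (fun h => ip h f0 *: f0) => h; split.
    by apply/sa_wanderingE; rewrite ipZl f0_unit mulr1.
  move=> g /sa_wanderingE ->.
  by rewrite ipZr linearBl /= ipZl f0_unit mulr1 subrr mulr0.
apply/funext => h; have [/sa_wanderingE -> ort] := XP h; congr (_ *: _).
have /ort : sa_wandering M f0 by apply/sa_wanderingE; rewrite f0_unit scale1r.
by rewrite linearBl /= ipZl f0_unit mulr1 => /eqP; rewrite subr_eq0 => /eqP.
Qed.

(** Both products collapse since [M B] differs from the identity by a multiple
    of [f0], which [D] and [D^-1] keep on its line and [B] kills. *)
Let BDMi : op_inv (B \o D \o M) = B \o Di \o M.
Proof.
have Bf0 : B f0 = 0 := shimorin_inv_kernel.
apply: op_inv_eq; split.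
- by apply: bounded_op_comp => //; apply: bounded_op_comp.
- apply/funext => h /=; rewrite MB bounded_opD // DiK -scaleNr bounded_opZ //.
  rewrite Dif0 bounded_opD // !(bounded_opZ _ _ bB) Bf0 !scaler0 addr0.
  exact: shimorin_invK.
- apply/funext => h /=; rewrite MB bounded_opD // DKi -scaleNr bounded_opZ //.
  rewrite Df0 bounded_opD // !(bounded_opZ _ _ bB) Bf0 !scaler0 addr0.
  exact: shimorin_invK.
Qed.

(** The Shimorin inverse of the Aluthge transform is similar to that of [M]
    through the same [Q]; all powers are then those of [B], conjugated once. *)
Let saE : sa_left_inv M = Q \o B \o Qi.
Proof.
have Bf0 : B f0 = 0 := shimorin_inv_kernel.
apply/funext => h; rewrite /sa_left_inv -/D -/B -/Q BDMi /=.
rewrite MB (bounded_opD _ _ bDi) DiQ -scaleNr (bounded_opZ _ _ bDi) Dif0.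
by rewrite (bounded_opD _ _ bB) !(bounded_opZ _ _ bB) Bf0 !scaler0 addr0.
Qed.

Let bL : bounded_op (sa_left_inv M).
Proof. by rewrite saE; apply: bounded_op_comp => //; apply: bounded_op_comp. Qed.

Let sa_adj : adjoint (sa_left_inv M) = Qi \o adjoint B \o Q.
Proof. by apply: adjoint_eq => g h; rewrite saE /= symQ (adjointP eB) // symQi. Qed.

Let iter_sa_adj n : iter n (adjoint (sa_left_inv M)) f0
  = qq *: Qi (iter n (adjoint B) f0).
Proof.
have bBs := bounded_op_adjoint eB bB.
have -> h : iter n (adjoint (sa_left_inv M)) h = Qi (iter n (adjoint B) (Q h)).
  by elim: n => [|n IH]; rewrite ?QiK // iterS IH sa_adj /= QKi.
by rewrite Qf0 (bounded_opZ _ _ (bounded_op_iter n bBs)) bounded_opZ.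
Qed.

(** The coefficient of [z^m conj(w)^n] is the compression of [L^m L*^n] to the
    wandering line. *)
Lemma sa_kernel_expansion :
  kernel_expansion (sa_wandering M) (sa_disc M) (sa_kernel M)
    (fun m n => orth_proj (sa_wandering M) \o iter m (sa_left_inv M)
                  \o iter n (adjoint (sa_left_inv M))).
Proof.
apply: kernel_expansion_resolvents => //.
- rewrite orth_proj_wandering; apply: (bounded_opI (c := `|f0| * `|f0|)).
    by move=> a u v; rewrite linearDl /= ipZl scalerDl scalerA.
  move=> h; rewrite normrZ mulrAC ler_wpM2r //.
  by rewrite mulrC; exact: cauchy_schwarz.
- exact: (bounded_op_adjoint eB).
- move=> h; rewrite orth_proj_wandering; apply/sa_wanderingE.
  by rewrite ipZl f0_unit mulr1.
- exact: sa_disc_ball.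
Qed.

(** With [L = Q B Q^-1] and [Q f0] a multiple of [f0], the scalar
    [ip (L^m L*^n f0) f0] is a positive multiple of
    [ip (Q^-1 B*^n f0) (Q^-1 B*^m f0) = ip (D^-1 B*^n f0) (B*^m f0)]. *)
Lemma tridiagonal_sa_kernelP :
  tridiagonal_kernel (sa_wandering M) (sa_disc M) (sa_kernel M) <->
  forall m n, (m.+2 <= n)%N || (n.+2 <= m)%N ->
    ip (op_inv (op_abs M) (iter n (adjoint (shimorin_inv M)) f0))
       (iter m (adjoint (shimorin_inv M)) f0) = 0.
Proof.
have Wf0 : sa_wandering M f0 by apply/sa_wanderingE; rewrite f0_unit scale1r.
have coefE m n : ip (iter m (sa_left_inv M) (iter n (adjoint (sa_left_inv M)) f0)) f0
   = dd * ip (Di (iter n (adjoint B) f0)) (iter m (adjoint B) f0).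
  rewrite (iter_adjoint (S := adjoint (sa_left_inv M))); last exact: (adjointP eB).
  rewrite !iter_sa_adj ipZl ipZr -symQi QiQi mulrA conj_Creal ?gtr0_real //.
  by rewrite -expr2 sqrtCK.
split=> [[C' [expC' C'0]] m n mn|Hz].
  have := kernel_expansion_unique m n sa_kernel_expansion expC' Wf0.
  rewrite (C'0 m n mn _ Wf0) orth_proj_wandering /= coefE => /eqP.
  rewrite scaler_eq0 mulf_eq0 gt_eqF //= => /orP[/eqP //|/eqP f00].
  by move: f0_unit; rewrite f00 linear0l => /esym/eqP; rewrite oner_eq0.
exists (fun m n => orth_proj (sa_wandering M) \o iter m (sa_left_inv M)
                  \o iter n (adjoint (sa_left_inv M))).
split=> [|m n mn h]; first exact: sa_kernel_expansion.
move=> /sa_wanderingE ->; rewrite orth_proj_wandering /=.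
rewrite (bounded_opZ _ _ (bounded_op_iter n (bounded_op_adjoint eB bL))).
rewrite (bounded_opZ _ _ (bounded_op_iter m bL)) ipZl coefE Hz //.
by rewrite !mulr0 scale0r.
Qed.

End ShimorinAluthge.

(** * The shift on a truncated tridiagonal space *)

Section TruncatedSpace.
Variables (R : realType) (k : R[i] -> R[i] -> R[i]) (H : rkhs k).
Local Notation C := R[i].
Implicit Types (u v h : H) (T S : H -> H).

(** The prescription is a weighted shift up to finitely many basis vectors, and
    these are corrected by a finite-rank operator. *)
Lemma banded_op_exists (f y : nat -> H) (c : nat -> C) (b : C) (N : nat) :
  orthonormal_basis f -> (forall n, `|c n| <= b) ->
  (forall n, (N <= n)%N -> y n = c n *: f n.+1) ->
  exists2 T, bounded_op T & forall n, T (f n) = y n.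
Proof.
move=> fB cb yN.
have oS : orthonormal_seq (fun n => f n.+1) by move=> m n; rewrite fB.1 eqSS.
have [S bS Sf] := weighted_op_exists fB oS cb.
pose F h := \sum_(i < N) ip h (f i) *: (y i - c i *: f i.+1).
exists (fun h => S h + F h).
  apply: bounded_op_add => //.
  exact: (bounded_finite_rank N f (fun i => y i - c i *: f i.+1)).
move=> n; rewrite Sf /F; have [nN|Nn] := ltnP n N.
  rewrite (bigD1 (Ordinal nN)) //= fB.1 eqxx scale1r big1 ?addr0.
    by rewrite addrC subrK.
  by move=> i /negPf ni; rewrite fB.1 eq_sym (_ : (i : nat) == n = false) ?scale0r.
rewrite big1 ?addr0 ?yN // => i _.
by rewrite fB.1 gtn_eqF ?scale0r // (leq_trans (ltn_ord i)).
Qed.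

Variables (r : nat) (a b : nat -> C) (f : nat -> H).
Hypothesis Htrunc : truncated_space r a b f.

Lemma truncated_onb : orthonormal_basis f.
Proof. by case: Htrunc => -[_ [_ []]]. Qed.
Local Notation fB := truncated_onb.

Lemma truncated_a_neq0 n : a n != 0.
Proof. by case: Htrunc => -[_ [[]]]. Qed.
Local Notation a0 := truncated_a_neq0.

Lemma truncated_b0 n : ~~ (2 <= n <= r)%N -> b n = 0.
Proof. by case: Htrunc => _; exact. Qed.

Lemma truncated_b0_gt n : (r < n)%N -> b n = 0.
Proof. by move=> rn; apply: truncated_b0; rewrite negb_and -!ltnNge rn orbT. Qed.

Lemma monomial_exists : exists p : nat -> H,
  forall n z, unit_disc z -> ev (p n) z = z ^+ n.
Proof.
have /choice[p Hp] : forall n, exists h : H,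
    forall z, unit_disc z -> ev h z = z ^+ n.
  case: Htrunc => -[[_ _ polys _] _] _ n.
  have [h Hh] := polys 'X^n; exists h => z /Hh ->.
  by rewrite hornerXn.
by exists p.
Qed.

Definition monomial : nat -> H := projT1 (cid monomial_exists).
Local Notation p := monomial.

Lemma ev_monomial n z : unit_disc z -> ev (p n) z = z ^+ n.
Proof. exact: (projT2 (cid monomial_exists)). Qed.

Lemma basis_monomial n : f n = a n *: p n + b n *: p n.+1.
Proof.
apply: ev_inj => z zD.
have z0 : ev (0 : H) z = 0.
  have := ev_linear (-1) (0 : H) 0 zD.
  by rewrite scaler0 addr0 mulN1r addNr.
have -> : a n *: p n + b n *: p n.+1 = a n *: p n + (b n *: p n.+1 + 0) by rewrite addr0.
rewrite !ev_linear // z0 addr0 !ev_monomial //.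
case: Htrunc => -[_ [_ [-> // _]]] _.
by rewrite exprS; ring.
Qed.

(** Since [b n = 0] beyond [r], the image of [f n] is [(a n / a n.+1) *: f n.+1]
    there, so [banded_op_exists] applies; that the result multiplies by [z] is
    tested on the basis against the reproducing kernel. *)
Lemma mult_z_exists : exists2 T : H -> H, bounded_op T &
  forall h w, unit_disc w -> ev (T h) w = w * ev h w.
Proof.
pose y n := a n *: p n.+1 + b n *: p n.+2.
have [B cB] : exists B : R, forall n, Normc.normc (a n / a n.+1) <= B.
  by case: Htrunc => -[_ [[]]].
have [||T bT Tf] := @banded_op_exists f y (fun n => a n / a n.+1) B%:C%C r.+1 fB.
- by move=> n; have := cB n; rewrite -lecR.
- move=> n rn; rewrite /y (truncated_b0_gt rn) scale0r addr0.
  rewrite basis_monomial (truncated_b0_gt (leqW rn)) scale0r addr0 scalerA.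
  by rewrite divfK // a0.
exists T => // h w wD.
have [kw [_ kwr]] := @ev_reproducing _ _ H _ wD.
rewrite -!kwr (adjointP fB) //.
have -> : adjoint T kw = w^* *: kw; last by rewrite ipZr conjCK.
apply: (onb_extr fB) => n; rewrite -(adjointP fB) // Tf basis_monomial ipZr conjCK.
rewrite /y !linearDl /= !ipZl !kwr !ev_monomial // !exprS; ring.
Qed.

Local Notation M := (mult_z H).

Lemma mult_zP :
  bounded_op M /\ forall h w, unit_disc w -> ev (M h) w = w * ev h w.
Proof.
have [T bT Tev] := mult_z_exists.
have Mev : forall h w, unit_disc w -> ev (M h) w = w * ev h w.
  apply: (getPex (P := [set T : H -> H | forall h w, unit_disc w ->
    ev (T h) w = w * ev h w])).
  by exists T.
split=> //; suff -> : M = T by [].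
by apply/funext => h; apply: ev_inj => z zD; rewrite Mev // Tev.
Qed.

Let bM : bounded_op M := mult_zP.1.

Lemma mult_z_monomial n : M (p n) = p n.+1.
Proof.
apply: ev_inj => z zD; rewrite mult_zP.2 // !ev_monomial //.
by rewrite exprS.
Qed.

(** The representer of the [n]-th Taylor coefficient at the origin, read off
    from [f n = a n z^n + b n z^(n+1)]; see [ip_monomial_coef_repr]. *)
Definition coef_repr n : H :=
  (a n)^* *: f n + (if n is m.+1 then (b m)^* *: f m else 0).
Local Notation g := coef_repr.

Lemma ip_coef_repr_succ h n :
  ip h (g n.+1) = a n.+1 * ip h (f n.+1) + b n * ip h (f n).
Proof. by rewrite /g linearDr /= !ipZr !conjCK. Qed.

Lemma ip_coef_repr0 h : ip h (g 0%N) = a 0%N * ip h (f 0%N).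
Proof. by rewrite /g addr0 ipZr conjCK. Qed.

Lemma ip_basis_coef_repr j n :
  ip (f j) (g n) = (j == n)%:R * a j + (j.+1 == n)%:R * b j.
Proof.
case: n => [|n].
  rewrite ip_coef_repr0 fB.1 mul0r addr0 mulrC.
  by case: eqP => [->|_]; rewrite ?mul0r.
rewrite ip_coef_repr_succ !fB.1 eqSS.
congr (_ + _); rewrite mulrC; case: eqP => [->|_] //; by rewrite !mul0r.
Qed.

(** Descending induction on the degree [j]: beyond [r] the monomial is a multiple
    of [f j], and below, [a j z^j = f j - b j z^(j+1)]. *)
Lemma ip_monomial_coef_repr j n : ip (p j) (g n) = (j == n)%:R.
Proof.
have pE i : p i = (a i)^-1 *: (f i - b i *: p i.+1).
  by rewrite basis_monomial addrK scalerK // a0.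
suff H0 d : forall i, (r < i + d)%N -> ip (p i) (g n) = (i == n)%:R.
  by apply: (H0 r.+1); rewrite leq_addl.
elim: d => [|d IH] i; rewrite pE ipZl linearBl /= ipZl ip_basis_coef_repr.
  rewrite addn0 => ri; rewrite truncated_b0_gt // mul0r subr0 mulr0 addr0.
  by rewrite mulrCA mulVf ?mulr1 // a0.
rewrite addnS -addSn => /IH ->.
by rewrite mulrC [b i * _]mulrC addrK -mulrA mulfV ?mulr1 // a0.
Qed.

Lemma coef_repr_total h : (forall n, ip h (g n) = 0) -> h = 0.
Proof.
move=> hg; apply: (onb_ext fB) => n; rewrite linear0l.
elim: n => [|n IH].
  by have /eqP := hg 0%N; rewrite ip_coef_repr0 mulf_eq0 (negPf (a0 0)) => /eqP.
have /eqP := hg n.+1; rewrite ip_coef_repr_succ IH mulr0 addr0.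
by rewrite mulf_eq0 (negPf (a0 n.+1)) => /eqP.
Qed.

Lemma adjoint_mult_z_coef_repr n : adjoint M (g n.+1) = g n.
Proof.
apply: (onb_extr fB) => j; rewrite -(adjointP fB) // basis_monomial.
rewrite (bounded_opD _ _ bM) !(bounded_opZ _ _ bM) !mult_z_monomial.
by rewrite !linearDl /= !ipZl !ip_monomial_coef_repr !eqSS.
Qed.

Lemma adjoint_mult_z_basis0 : adjoint M (f 0%N) = 0.
Proof.
apply: (onb_extr fB) => j; rewrite -(adjointP fB) // linear0r /= basis_monomial.
rewrite (bounded_opD _ _ bM) !(bounded_opZ _ _ bM) !mult_z_monomial linearDl /= !ipZl.
have pf i : ip (p i.+1) (f 0%N) = 0.
  have := ip_monomial_coef_repr i.+1 0; rewrite ip_coef_repr0 => /eqP.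
  by rewrite mulf_eq0 (negPf (a0 0)) => /eqP.
by rewrite !pf !mulr0 addr0.
Qed.

Lemma mult_z_inj h : M h = 0 -> h = 0.
Proof.
move=> Mh; apply: coef_repr_total => n.
by rewrite -adjoint_mult_z_coef_repr -(adjointP fB) // Mh linear0l.
Qed.

Lemma adjoint_mult_z_ker h : adjoint M h = 0 -> h = ip h (f 0%N) *: f 0%N.
Proof.
move=> Mh; have ph n : ip (p n.+1) h = 0.
  by rewrite -mult_z_monomial (adjointP fB) // Mh linear0r.
apply: (onb_ext fB) => -[|n]; rewrite ipZl fB.1 ?mulr1 // mulr0.
by rewrite ip_conj basis_monomial linearDl /= !ipZl !ph !mulr0 addr0 rmorph0.
Qed.

Definition weight n : C := `|a n / a n.+1| ^+ 2.

Lemma weight_gt0 n : 0 < weight n.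
Proof. by rewrite exprn_gt0 // normr_gt0 mulf_neq0 ?invr_neq0 ?a0. Qed.

(** When the neighbouring [b]'s vanish, [f n] and [f n.+1] are multiples both of
    monomials, on which [M] shifts up, and of Taylor representers, on which [M*]
    shifts down. *)
Lemma gram_mult_z_basis n : b n.-1 = 0 -> b n = 0 -> b n.+1 = 0 ->
  adjoint M (M (f n)) = weight n *: f n.
Proof.
move=> b1 b2 b3.
have an0 := a0 n.+1.
have gE m : b m.-1 = 0 -> g m = (a m)^* *: f m.
  by case: m => [|m] /= bm; rewrite /g ?addr0 // bm rmorph0 scale0r addr0.
have MfE : M (f n) = (a n / a n.+1) *: f n.+1.
  rewrite (basis_monomial n) b2 scale0r addr0 bounded_opZ // mult_z_monomial.
  by rewrite basis_monomial b3 scale0r addr0 scalerA divfK.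
have fE : f n.+1 = (a n.+1)^*^-1 *: g n.+1.
  by rewrite gE //= scalerK // conjC_eq0.
have bMs := bounded_op_adjoint fB bM.
rewrite MfE bounded_opZ // fE bounded_opZ // adjoint_mult_z_coef_repr gE //.
rewrite !scalerA; congr (_ *: _); rewrite /weight normCK rmorphM fmorphV /=.
by ring.
Qed.

Lemma gram_mult_z_sym u v :
  ip (adjoint M (M u)) v = ip u (adjoint M (M v)).
Proof. by rewrite (adjointPr fB) // (adjointP fB). Qed.

(** The only non-diagonal block of [M* M] lies in the first [r + 2] indices.  Its
    finitely many eigenvalues are positive by injectivity of [M], the others are
    bounded below by hypothesis on the ratios [a n / a n.+1]. *)
Lemma gram_eigenbasis : exists e lam c, [/\ orthonormal_basis e,
  diagonal_op e lam (adjoint M \o M), forall n, 0 < lam n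
  & forall n, `|(lam n)^-1| <= c].
Proof.
have bA : bounded_op (adjoint M \o M).
  by apply: bounded_op_comp => //; exact: (bounded_op_adjoint fB).
have Af n : (r.+2 <= n)%N -> (adjoint M \o M) (f n) = weight n *: f n.
  move=> rn; apply: gram_mult_z_basis; apply: truncated_b0_gt.
  - by case: n rn.
  - exact: ltnW.
  - by apply: leqW; exact: ltnW.
have [e [lam [eB Ae lamE]]] := block_eigenbasis fB bA gram_mult_z_sym Af.
have lam0 n : 0 < lam n.
  have -> : lam n = `|M (e n)| ^+ 2.
    rewrite -ip_norm -(adjointPr fB) //.
    by have /= -> := Ae.2 n; rewrite ipZl eB.1 eqxx mulr1.
  rewrite exprn_gt0 // normr_gt0; apply/eqP => /mult_z_inj en0.
  by have := eB.1 n n; rewrite en0 linear0l eqxx => /esym/eqP; rewrite oner_eq0.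
have [c [c0 cb]] : exists c : R, 0 < c /\ forall n, c <= Normc.normc (a n / a n.+1).
  by case: Htrunc => -[_ [[_ _ _ [c c0 cb]] _]] _; exists c.
pose s := \sum_(i < r.+2) (lam i)^-1.
have s0 : 0 <= s by rewrite sumr_ge0 // => i _; rewrite invr_ge0 ltW.
have c0' : 0 < c%:C%C :> C by rewrite ltcR.
have cc0 : 0 < (c%:C%C ^+ 2)^-1 :> C by rewrite invr_gt0 exprn_gt0 // ltcR.
exists e, lam, (s + (c%:C%C ^+ 2)^-1); split=> // n.
rewrite gtr0_norm ?invr_gt0 //; have [nr|rn] := ltnP n r.+2.
  apply: (@le_trans _ _ s); last by rewrite lerDl ltW.
  rewrite /s (bigD1 (Ordinal nr)) //= lerDl sumr_ge0 // => i _.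
  by rewrite invr_ge0 ltW.
rewrite lamE // ler_wpDl // lef_pV2 ?posrE ?weight_gt0 ?exprn_gt0 ?ltcR //.
have cn : c%:C%C <= `|a n / a n.+1| by have := cb n; rewrite -lecR.
by rewrite /weight lerXn2r ?nnegrE //; exact: ltW c0'.
Qed.

Let setup := gram_eigenbasis.

Let Af0 : adjoint M (M (f 0%N)) = weight 0 *: f 0%N.
Proof. by apply: gram_mult_z_basis; apply: truncated_b0. Qed.

Let f0_unit : ip (f 0%N) (f 0%N) = 1. Proof. by rewrite fB.1. Qed.

Local Notation B := (shimorin_inv M).
Local Notation Di := (op_inv (op_abs M)).

(** [B] is the backward shift of Taylor coefficients: [M*] sends both sides to
    [g n], so their difference lies in the line of [f 0], to which both are
    orthogonal. *)
Lemma adjoint_shimorin_coef_repr n : adjoint B (g n) = g n.+1.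
Proof.
have [e [lam [c [eB Ae lam0 lamV]]]] := setup.
have bB := bounded_shimorin_inv bM eB Ae lam0 lamV.
have bMs := bounded_op_adjoint fB bM.
have Ms0 : adjoint M (adjoint B (g n) - g n.+1) = 0.
  rewrite bounded_opD // -scaleN1r bounded_opZ // scaleN1r adjoint_mult_z_coef_repr.
  apply/eqP; rewrite subr_eq0; apply/eqP; apply: ip_ext => h.
  by rewrite -(adjointP fB) // -(adjointP fB) // (shimorin_invK eB Ae lam0 lamV).
apply/eqP; rewrite -subr_eq0; apply/eqP.
rewrite (adjoint_mult_z_ker Ms0) linearBl /= (adjointPr fB) //.
rewrite (shimorin_inv_kernel eB Ae lam0 lamV adjoint_mult_z_basis0) linear0r.
rewrite [ip (g _) _]ip_conj ip_basis_coef_repr truncated_b0 // mulr0 addr0 mul0r.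
by rewrite rmorph0 subr0 scale0r.
Qed.

Lemma iter_adjoint_shimorin n : iter n (adjoint B) (f 0%N) = (a 0%N)^*^-1 *: g n.
Proof.
have [e [lam [c [eB Ae lam0 lamV]]]] := setup.
have bB := bounded_shimorin_inv bM eB Ae lam0 lamV.
have bBs := bounded_op_adjoint fB bB.
elim: n => [|n IH]; first by rewrite /g addr0 scalerK // conjC_eq0 a0.
by rewrite iterS IH bounded_opZ // adjoint_shimorin_coef_repr.
Qed.

Lemma abs_inv_mult_z_sym u v : ip (Di u) v = ip u (Di v).
Proof.
by have [e [lam [c [eB Ae lam0 lamV]]]] := setup; exact: (abs_inv_sym eB Ae lam0 lamV).
Qed.

Lemma bounded_abs_inv_mult_z : bounded_op Di.
Proof.
by have [e [lam [c [eB Ae lam0 lamV]]]] := setup; exact: (bounded_abs_inv eB Ae lam0 lamV).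
Qed.

(** [B*] shifts the representers [g n], so the coefficients of the kernel are the
    numbers [ip (|M|^-1 (g n)) (g m)] up to one positive factor; since [|M|^-1]
    is symmetric, the conditions above and below the diagonal are conjugate. *)
Lemma tridiagonal_mult_zP :
  tridiagonal_kernel (sa_wandering M) (sa_disc M) (sa_kernel M) <->
  forall m n, (m.+2 <= n)%N -> ip (Di (g n)) (g m) = 0.
Proof.
have [e [lam [c [eB Ae lam0 lamV]]]] := setup.
have bDi := bounded_abs_inv_mult_z.
have a00 : (a 0%N)^*^-1 != 0 by rewrite invr_eq0 conjC_eq0 a0.
apply: (iff_trans (tridiagonal_sa_kernelP bM eB Ae lam0 lamV f0_unit
   adjoint_mult_z_basis0 adjoint_mult_z_ker (weight_gt0 0) Af0)).
split=> Hz m n mn.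
  have := Hz m n; rewrite mn => /(_ isT); rewrite !iter_adjoint_shimorin.
  rewrite bounded_opZ // ipZl ipZr => /eqP.
  by rewrite !mulf_eq0 conjC_eq0 (negPf a00) => /eqP.
rewrite !iter_adjoint_shimorin bounded_opZ // ipZl ipZr.
case/orP: mn => /Hz E; first by rewrite E !mulr0.
by rewrite abs_inv_mult_z_sym ip_conj E rmorph0 !mulr0.
Qed.

(** The indices [0] and those beyond [r + 1] belong to eigenvectors of [|M|]. *)
Lemma abs_inv_coef_eq0 m n : (m < n)%N -> (m == 0)%N || (r.+1 < n)%N ->
  abs_inv_coef f m n = 0.
Proof.
have [e [lam [c [eB Ae lam0 lamV]]]] := setup.
have E l : adjoint M (M (f l)) = weight l *: f l ->
    Di (f l) = (sqrtC (weight l))^-1 *: f l.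
  exact: (abs_inv_eigen eB Ae lam0 lamV (weight_gt0 l)).
rewrite /abs_inv_coef => mn /orP[/eqP m0|rn].
  by rewrite abs_inv_mult_z_sym m0 (E _ Af0) ipZr fB.1 gtn_eqF ?mulr0 // -m0.
have An : adjoint M (M (f n)) = weight n *: f n.
  apply: gram_mult_z_basis; apply: truncated_b0_gt.
  - by case: n rn {mn}.
  - exact: ltnW.
  - by apply: leqW; exact: ltnW.
by rewrite (E _ An) ipZl fB.1 gtn_eqF ?mulr0.
Qed.

Lemma ip_abs_inv_coef_repr m n : ip (Di (g n.+1)) (f m) =
  (a n.+1)^* * abs_inv_coef f m n.+1 + (b n)^* * abs_inv_coef f m n.
Proof.
have bDi := bounded_abs_inv_mult_z.
by rewrite /g (bounded_opD _ _ bDi) !(bounded_opZ _ _ bDi) linearDl /= !ipZl.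
Qed.

(** The second argument is peeled off first: [ip (|M|^-1 (g n)) (g m.+1)] is
    [a m.+1] times the pairing with [f m.+1] plus [b m] times the pairing with
    [f m].  Far from the diagonal, induction on [m] turns the vanishing of all
    pairings with the [g m] into that of all pairings with the [f m]. *)
Lemma tridiagonal_mult_z_recurrence :
  tridiagonal_kernel (sa_wandering M) (sa_disc M) (sa_kernel M) <->
  forall m n, (m < n)%N ->
    (a n.+1)^* * abs_inv_coef f m n.+1 + (b n)^* * abs_inv_coef f m n = 0.
Proof.
apply: (iff_trans tridiagonal_mult_zP); split=> Hz; last first.
  move=> [|m] [|n] // mn; rewrite ?ip_coef_repr0 ?ip_coef_repr_succ.
    by rewrite ip_abs_inv_coef_repr Hz ?mulr0.
  by rewrite !ip_abs_inv_coef_repr !Hz ?mulr0 ?addr0 // ltnW.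
elim=> [|m IH] n mn; rewrite -ip_abs_inv_coef_repr.
  have /eqP := Hz 0%N n.+1 mn; rewrite ip_coef_repr0 mulf_eq0 (negPf (a0 0)).
  by move=> /eqP.
have := Hz m.+1 n.+1 mn; rewrite ip_coef_repr_succ [X in _ + _ * X]ip_abs_inv_coef_repr.
rewrite IH ?(ltnW mn) // mulr0 addr0 => /eqP.
by rewrite mulf_eq0 (negPf (a0 m.+1)) => /eqP.
Qed.

End TruncatedSpace.

(** * The two-term recurrence and the theorem *)

Section ClosedForm.
Variables (F : fieldType) (al be c : nat -> F) (m : nat).
Hypothesis al0 : forall n, al n != 0.

(** The solution, from the initial value [c m.+1], of
    [al n.+1 * x n.+1 + be n * x n = 0] for [n > m]. *)
Definition recurrence_solution n : F :=
  (-1) ^+ (n - m - 1)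
  * ((\prod_(m.+1 <= j < n) be j) / (\prod_(m.+2 <= j < n.+1) al j))
  * c m.+1.
Local Notation sol := recurrence_solution.

Lemma recurrence_solution_start : sol m.+1 = c m.+1.
Proof. by rewrite /sol subSn // subnn !big_geq // divr1 !mul1r. Qed.

Lemma recurrence_solution_step n : (m < n)%N ->
  al n.+1 * sol n.+1 + be n * sol n = 0.
Proof.
move=> mn; rewrite /sol; have -> : (n.+1 - m - 1 = (n - m - 1).+1)%N by lia.
rewrite [\prod_(m.+1 <= j < n.+1) _]big_nat_recr //=.
rewrite [\prod_(m.+2 <= j < n.+2) _]big_nat_recr //= exprS invfM.
set x := (-1) ^+ _; set y := \prod_(_ <= _ < n) _; set z := (\prod_(_ <= _ < _) _)^-1.
have := mulfV (al0 n.+1); set t := (al n.+1)^-1 => alt.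
transitivity (be n * x * y * z * c m.+1 * (1 - al n.+1 * t)); last by rewrite alt subrr mulr0.
by ring.
Qed.

Lemma recurrence_closed_form :
  (forall n, (m < n)%N -> al n.+1 * c n.+1 + be n * c n = 0) ->
  forall n, (m < n)%N -> c n = sol n.
Proof.
move=> rec; elim=> // n IH; rewrite ltnS leq_eqVlt => /orP[/eqP <-|mn].
  by rewrite recurrence_solution_start.
apply: (mulfI (al0 n.+1)); apply: (addIr (be n * sol n)).
by rewrite recurrence_solution_step // -IH // rec.
Qed.

End ClosedForm.

Theorem theorem8p3 (R : realType) (k : R[i] -> R[i] -> R[i]) (H : rkhs k)
    (r : nat) (a b : nat -> R[i]) (f : nat -> H)
    (r_ge2 : (2 <= r)%N) (Htrunc : truncated_space r a b f) :
  tridiagonal_kernel (sa_wandering (mult_z H)) (sa_disc (mult_z H))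
    (sa_kernel (mult_z H)) <->
  (forall m n : nat, (1 <= m <= n - 2)%N -> (3 <= n <= r.+1)%N ->
    abs_inv_coef f m n =
      (-1) ^+ (n - m - 1)
      * ((\prod_(m.+1 <= j < n) Num.conj (b j))
         / (\prod_(m.+2 <= j < n.+1) Num.conj (a j)))
      * abs_inv_coef f m m.+1).
Proof.
have a0 n : (a n)^* != 0 by rewrite conjC_eq0 (truncated_a_neq0 Htrunc).
apply: (iff_trans (tridiagonal_mult_z_recurrence Htrunc)).
split=> [rec m n mn _|formula [|m] n mn].
- have lt_mn : (m < n)%N by lia.
  exact: (@recurrence_closed_form _ (fun i => (a i)^*) (fun i => (b i)^*)
    (abs_inv_coef f m) m a0 (rec m) n lt_mn).
- by rewrite !(abs_inv_coef_eq0 Htrunc) // !mulr0 addr0.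
have [nr|rn] := leqP n r; last first.
  rewrite (truncated_b0_gt Htrunc rn) rmorph0 mul0r addr0.
  by rewrite (abs_inv_coef_eq0 Htrunc) ?mulr0 // ltnW.
pose sol := recurrence_solution (fun i => (a i)^*) (fun i => (b i)^*)
  (abs_inv_coef f m.+1) m.+1.
have solE l : (m.+1 < l <= r.+1)%N -> abs_inv_coef f m.+1 l = sol l.
  move=> /andP[ml lr]; have [<-|ml'] := eqVneq m.+2 l.
    by rewrite /sol recurrence_solution_start.
  by apply: formula; lia.
rewrite !solE ?mn ?(leqW nr) //; last by rewrite ltnW // ltnS.
exact: (recurrence_solution_step _ _ a0).
Qed.
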